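(* Let $k \geq 4$ be fixed. Then $$\mathrm{ex}(v, C_{2k}, \mathcal{C}_{\mathrm{odd}} \cup \{C_4\}) = \left(\frac{1}{2^{k+1}k} - o(1)\right)v^k \quad \text{as } v \to \infty.$$
   Context: $C_m$ denotes the cycle of length $m$ and $\mathcal{C}_{\mathrm{odd}} = \{C_3, C_5, C_7, \dots\}$ is the set of all odd cycles. $\mathrm{ex}(v, C_{2k}, \mathcal{C}_{\mathrm{odd}} \cup \{C_4\})$ denotes the maximum number of copies of $C_{2k}$ (cycles of length $2k$ as subgraphs) in a graph on $v$ vertices that contains no odd cycle and no $C_4$ as a subgraph (i.e. a bipartite graph with no $4$-cycle). *)

(* Defs.v *)
From mathcomp Require Import all_boot.
From mathcomp Require Import boolp.

Set Implicit Arguments.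
Unset Strict Implicit.
Unset Printing Implicit Defensive.

(* A simple graph with vertex type T is given by its edge set E : {set {set T}},
   whose members are the two-element sets of adjacent vertices. *)
Definition simple_graph (T : finType) (E : {set {set T}}) : bool :=
  [forall e in E, #|e| == 2].

(* The edges are {i, i+1 mod m}; this is the cycle of length m when 3 <= m. *)
Definition cycle_graph (m : nat) : {set {set 'I_m}} :=
  [set [set i; ordS i] | i : 'I_m].

(* The copies of H in E are unlabelled: they are the subgraphs (W, F) of E, with
   vertex set W and edge set F, that are isomorphic to H. *)
Definition copies (U T : finType) (H : {set {set U}}) (E : {set {set T}}) :
    {set {set T} * {set {set T}}} :=
  [set S : {set T} * {set {set T}} | (S.2 \subset E) &&
    [exists f : {ffun U -> T}, injectiveb f &&
      (S == (f @: [set: U], [set f @: e | e : {set U} in H]))]].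

Definition graph_family := forall m : nat, {set {set 'I_m}} -> Prop.

Definition family_free (T : finType) (Fam : graph_family)
    (E : {set {set T}}) : Prop :=
  forall (m : nat) (F : {set {set 'I_m}}), Fam m F -> copies F E = set0.

Definition ex_turan (v : nat) (U : finType) (H : {set {set U}})
    (Fam : graph_family) : nat :=
  \max_(E : {set {set 'I_v}} | simple_graph E && `[< family_free Fam E >])
    #|copies H E|.

Variant odd_cycles_and_C4 : graph_family :=
  | Odd_cycle (m : nat) of 3 <= m & odd m : odd_cycles_and_C4 (cycle_graph m)
  | Four_cycle : odd_cycles_and_C4 (cycle_graph 4).

(* Main.v *)
Require Import Defs.
From mathcomp Require Import all_boot all_order all_algebra.
From mathcomp Require Import all_classical all_reals all_analysis.
From mathcomp Require Import finfield zify ring lra.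

Set Implicit Arguments.
Unset Strict Implicit.
Unset Printing Implicit Defensive.

Import Order.TTheory GRing.Theory Num.Theory.
Local Open Scope ring_scope.

(** A graph without odd cycles is bipartite, and without [C_4] a [2k]-cycle is
determined by its [k] vertices in either colour class; the smaller class has at
most [v/2] vertices and each copy has [4k] labellings, whence the upper bound
[v^k / (2^(k+1) k)].

For the lower bound, join the point [(x, y)] and the line [(a, b)] over the field
with [q] elements when [y = a x + b]. Almost every [k]-tuple of points is in
general position and closes up to a [2k]-cycle through points and lines, which
gives about [q^(2k) / (2k)] copies on [2 q^2] vertices.

To have [2 q^2] asymptotic to [v] for every large [v], one needs a prime power
between [x] and [(1 + e) x] for all large [x]. Selberg's formula
[psi x ln x + sum_n Lambda(n) psi(x/n) = 2 x ln x + O(x)] is proved with the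
Tatuzawa-Iseki identity, and then Erdos's argument applies: let [L > 1] be the
largest ratio such that [psi (L x) - psi x = o(x)] along some [x -> oo]. Selberg's
formula forces [psi] to have density [2] on the intervals [(x/n, L x/n]] for almost
all [n] (weighted by [Lambda(n)/n]); by the maximality of [L] such [n] are dense
enough for these intervals to cover a long interval up to small gaps, so that
[psi] has density almost [2] there, against Chebyshev's bound
[psi x <= 1.9 x + O(1)]. *)

(** * Arithmetic functions and Selberg's formula *)

Section DivisorSums.
Variable V : nmodType.
Implicit Types (N d : nat).

Lemma sum_multiples N d (g : nat -> V) : (0 < d)%N ->
  \sum_(1 <= m < N.+1 | (d %| m)%N) g m
    = \sum_(1 <= n < (N %/ d)%N.+1) g (d * n)%N.
Proof.
move=> d0; elim: N => [|N IH]; first by rewrite div0n !big_geq.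
rewrite big_mkcond big_nat_recr //= -big_mkcond IH divnS //.
case: ifP => [dvd|_]; last by rewrite add0n addr0.
rewrite add1n [RHS]big_nat_recr //=; congr (_ + g _).
by have := divnK dvd; rewrite divnS // dvd add1n mulnC.
Qed.

(** Both sides run over the pairs with [d * n <= N], grouped by [d] or by the product. *)
Lemma sum_hyperbola N (h : nat -> nat -> V) :
  \sum_(1 <= d < N.+1) \sum_(1 <= n < (N %/ d)%N.+1) h d (d * n)%N
    = \sum_(1 <= m < N.+1) \sum_(1 <= d < N.+1 | (d %| m)%N) h d m.
Proof.
rewrite (exchange_big_dep_nat xpredT) //=.
rewrite !big_nat; apply: eq_bigr => d /andP[d0 _].
by rewrite -(sum_multiples N (h d)).
Qed.

Lemma sum_divisors_widen N m (g : nat -> V) : (0 < m <= N)%N ->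
  \sum_(1 <= d < N.+1 | (d %| m)%N) g d = \sum_(1 <= d < m.+1 | (d %| m)%N) g d.
Proof.
move=> /andP[m0 mN]; rewrite (@big_cat_nat _ _ _ m.+1) //=.
rewrite [X in _ + X]big_nat_cond [X in _ + X]big1 ?addr0 // => i /andP[/andP[mi _] im].
by move: (dvdn_leq m0 im); rewrite leqNgt mi.
Qed.

End DivisorSums.

(** * The von Mangoldt and Moebius functions and the Tatuzawa-Iseki identity *)

Section ArithmeticFunctions.
Variable R : realType.
Implicit Types (n m d p N : nat).

Definition mangoldt n : R := if primes n is [:: p] then ln p%:R else 0.

Lemma mangoldt_ge0 n : 0 <= mangoldt n.
Proof.
rewrite /mangoldt; case: (primes n) => [|[|p]  [|q s]] //; last first.
  by apply: ln_ge0; rewrite ler1n.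
by rewrite ln0.
Qed.

Lemma primes1_pfactor n p : primes n = [:: p] ->
  prime p /\ n = (p ^ logn p n)%N.
Proof.
move=> E; have /[!mem_primes] /and3P[pp n0 _] : p \in primes n by rewrite E inE.
split=> //; have := prod_prime_decomp n0; rewrite prime_decompE E /= big_seq1.
by [].
Qed.

Lemma mangoldt_neq0 n : mangoldt n != 0 ->
  exists p j, [/\ prime p, (0 < j)%N & n = (p ^ j)%N].
Proof.
rewrite /mangoldt; case E: (primes n) => [|p [|? ?]]; rewrite ?eqxx // => _.
have [pp En] := primes1_pfactor E; exists p, (logn p n); split=> //.
rewrite lognE pp; have /[!mem_primes] /and3P[_ -> ->] // : p \in primes n.
by rewrite E inE.
Qed.

Lemma mangoldt_pfactor p j : prime p -> mangoldt (p ^ j.+1) = ln p%:R.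
Proof. by move=> pp; rewrite /mangoldt primesX // primes_prime. Qed.

(** Induction, splitting off one prime: [n = m * p]. Among the divisors of [n] that do not divide
    [m], only [p ^ (logn p m).+1] carries weight, namely [ln p]. *)
Lemma sum_mangoldt n : (0 < n)%N ->
  \sum_(1 <= d < n.+1 | (d %| n)%N) mangoldt d = ln n%:R.
Proof.
elim/ltn_ind: n => n IH n0; have [n1|] := leqP n 1.
  by have -> : n = 1%N; [lia|rewrite big_mkcond big_nat1 /= ln1].
move=> n1.
have pp := pdiv_prime n1; set p := pdiv n in pp *.
have p0 := prime_gt0 pp; have p1 := prime_gt1 pp.
have /dvdnP[m En] : (p %| n)%N := pdiv_dvd n.
have m0 : (0 < m)%N by rewrite lt0n; apply/eqP=> m0; move: n1; rewrite En m0.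
have mn : (m < n)%N by rewrite En ltn_Pmulr.
have mdn : (m %| n)%N by rewrite En dvdn_mulr.
rewrite (bigID (fun d => d %| m)%N) /=.
rewrite (eq_bigl (fun d => d %| m)%N); last first.
  move=> d; case dm : (d %| m)%N; rewrite ?andbF ?andbT //.
  exact: (dvdn_trans dm).
rewrite sum_divisors_widen ?m0 1?ltnW // IH //.
have pn : (p ^ (logn p m).+1 %| n)%N.
  by rewrite En expnSr dvdn_mul // pfactor_dvdnn.
have pm : ~~ (p ^ (logn p m).+1 %| m)%N by rewrite pfactor_dvdn // ltnn.
have K d : (d %| n)%N && ~~ (d %| m)%N -> d != (p ^ (logn p m).+1)%N -> mangoldt d = 0.
  move=> /andP[dn dm] dp; rewrite /mangoldt.
  case E : (primes d) => [|r [|? ?]] //; have [pr Ed] := primes1_pfactor E.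
  have [rp|rp] := eqVneq r p; last first.
    case/negP: dm; move: dn; rewrite En Ed Gauss_dvdl // coprimeXl //.
    by rewrite prime_coprime // dvdn_prime2.
  subst r; case/negP: dp; rewrite [X in X == _]Ed.
  move: dn dm; rewrite [X in (X %| _)%N]Ed [X in ~~ (X %| _)%N]Ed En !pfactor_dvdn // ?muln_gt0 ?m0 //.
  rewrite lognM // (pfactorK 1 pp : logn p p = 1)%N addn1 -ltnNge => a b.
  by apply/eqP; congr (p ^ _)%N; apply/eqP; rewrite eqn_leq a b.
rewrite -big_filter (bigD1_seq (p ^ (logn p m).+1)%N) /=; last 2 first.
- rewrite mem_filter pn pm mem_index_iota expn_gt0 p0 /= ltnS.
  by rewrite dvdn_leq // En muln_gt0 m0.
- exact/filter_uniq/iota_uniq.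
rewrite big_seq_cond big1 => [|d]; last first.
  by rewrite mem_filter => /andP[/andP[dd _] dp]; exact: K.
rewrite mangoldt_pfactor // addr0 En natrM lnM ?posrE ?ltr0n //.
Qed.

Definition moebius n : R :=
  if all (fun p => logn p n == 1)%N (primes n) then (-1) ^+ size (primes n) else 0.

Lemma normr_moebius_le1 n : `|moebius n| <= 1.
Proof.
by rewrite /moebius; case: ifP => _; rewrite ?normr0 // normrX normrN1 expr1n.
Qed.

Lemma moebius1 : moebius 1 = 1. Proof. by []. Qed.

Lemma moebius_mul_prime p d : prime p -> (0 < d)%N ->
  moebius (p * d) = if (p %| d)%N then 0 else - moebius d.
Proof.
move=> pp d0; have p0 := prime_gt0 pp; case: ifP => pd.
  rewrite /moebius; case: ifP => // /allP /(_ p).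
  rewrite mem_primes pp muln_gt0 p0 d0 dvdn_mulr // => /(_ isT).
  rewrite lognM // (pfactorK 1 pp : logn p p = 1)%N => /eqP[]; rewrite add0n => E.
  by have := pfactor_dvdn 1 pp d0; rewrite expn1 pd E.
have P : perm_eq (primes (p * d)) (p :: primes d).
  apply: uniq_perm; rewrite /= ?primes_uniq ?andbT ?mem_primes ?pd ?andbF //.
  by move=> r; rewrite primesM // primes_prime // !inE.
have lp : logn p d = 0%N by rewrite lognE pp d0 pd.
rewrite /moebius (perm_all _ P) (perm_size P) /= lognM // lp.
rewrite (pfactorK 1 pp : logn p p = 1)%N /=.
rewrite (@eq_in_all _ _ (fun r => logn r d == 1)%N) => [|r rd]; last first.
  move: rd; rewrite mem_primes => /and3P[pr _ rd].
  rewrite lognM // (_ : logn r p = 0%N) // lognE pr p0 /= dvdn_prime2 //.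
  by case: eqVneq => // rp; rewrite -rp rd in pd.
by case: ifP => _; rewrite ?oppr0 // exprS mulN1r.
Qed.

(** With [p] the least prime factor and [n = m * p], the divisors that are multiples [p * d]
    contribute [- moebius d] when [p] does not divide [d] and 0 otherwise. They cancel the divisors
    prime to [p]. *)
Lemma sum_moebius n : (0 < n)%N ->
  \sum_(1 <= d < n.+1 | (d %| n)%N) moebius d = (n == 1%N)%:R.
Proof.
move=> n0; have [n1|n1] := leqP n 1.
  by have -> : n = 1%N; [lia|rewrite big_mkcond big_nat1].
have pp := pdiv_prime n1; set p := pdiv n in pp *.
have p0 := prime_gt0 pp.
have /dvdnP[m En] : (p %| n)%N := pdiv_dvd n.
have m0 : (0 < m)%N by rewrite lt0n; apply/eqP=> m0; move: n1; rewrite En m0.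
have -> : (n == 1)%N = false by lia.
rewrite (bigID (fun d => p %| d)%N) /=.
rewrite (eq_bigl (fun d => (p %| d) && (d %| n))%N); last by move=> d; rewrite andbC.
rewrite big_mkcondr /= sum_multiples // [X in (X %/ p)%N]En mulnK //.
have -> : \sum_(1 <= d < m.+1) (if (p * d %| n)%N then moebius (p * d) else 0)
   = - \sum_(1 <= d < m.+1 | (d %| m)%N && ~~ (p %| d)%N) moebius d.
  rewrite -sumrN [RHS]big_mkcond /= !big_nat; apply: eq_bigr => d /andP[d0 _].
  rewrite En mulnC dvdn_pmul2r // mulnC moebius_mul_prime //.
  by case: (d %| m)%N => //=; case: (p %| d)%N.
apply/eqP; rewrite addrC subr_eq0; apply/eqP.
rewrite (eq_bigl (fun d => (d %| m) && ~~ (p %| d))%N); last first.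
  move=> d; case pd : (p %| d)%N; rewrite ?andbF ?andbT //=.
  by rewrite En Gauss_dvdl // coprime_sym prime_coprime // pd.
rewrite (@big_cat_nat _ _ _ m.+1) //=; last by rewrite En ltnS leq_pmulr.
rewrite [X in _ + X]big_nat_cond [X in _ + X]big1 ?addr0 //.
by move=> i /andP[/andP[mi _] /andP[/(dvdn_leq m0)]]; lia.
Qed.

(** Expand [ln (n / d)] by [sum_mangoldt] over the [e] dividing [n / d] and swap: the inner Moebius
    sum over the divisors of [n / e] leaves only [e = n]. *)
Lemma sum_moebius_ln n : (0 < n)%N ->
  \sum_(1 <= d < n.+1 | (d %| n)%N) moebius d * ln (n%:R / d%:R) = mangoldt n.
Proof.
move=> n0.
transitivity (\sum_(1 <= d < n.+1) \sum_(1 <= e < n.+1 | (d * e %| n)%N)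
   moebius d * mangoldt e).
  rewrite big_mkcond !big_nat; apply: eq_bigr => d /andP[d0 _].
  case: ifP => dn; last first.
    rewrite big_pred0 // => e; apply/negP => den.
    by rewrite (dvdn_trans _ den) ?dvdn_mulr in dn.
  have nd : (0 < n %/ d)%N by rewrite divn_gt0 // dvdn_leq.
  rewrite -big_distrr /= (eq_bigl (fun e => e %| n %/ d)%N); last first.
    by move=> e; rewrite -{1}(divnK dn) mulnC dvdn_pmul2r.
  rewrite sum_divisors_widen ?sum_mangoldt ?nd ?leq_div //.
  by rewrite -[X in X%:R / _](divnK dn) natrM mulfK ?pnatr_eq0 -?lt0n.
rewrite (exchange_big_dep_nat xpredT) //= big_nat_recr //=.
rewrite big_nat big1 ?add0r => [|e /andP[e0 en]].
  rewrite big_mkcond big_nat_recl //= mul1n dvdnn moebius1 mul1r.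
  rewrite big_nat big1 ?addr0 // => d d1; case: ifP => // /(dvdn_leq n0).
  by nia.
have [edn|edn] := boolP (e %| n)%N; last first.
  rewrite big_pred0 // => d; apply/negP => den.
  by rewrite (dvdn_trans _ den) ?dvdn_mull in edn.
have ne : (1 < n %/ e)%N by rewrite ltn_divRL // mul1n.
rewrite -big_distrl /= (eq_bigl (fun d => d %| n %/ e)%N); last first.
  by move=> d; rewrite -{1}(divnK edn) dvdn_pmul2r.
rewrite sum_divisors_widen ?sum_moebius 1?ltnW ?ltnS ?leq_div ?andbT //.
by rewrite (_ : (_ == _) = false) ?mul0r //; lia.
Qed.

(** Group by [m = d * n] and write [ln (N / d) = ln (N / m) + ln (m / d)]: the first part survives
    only at [m = 1], the second sums to [mangoldt m]. *)
Lemma tatuzawa_iseki N (F : nat -> R) : (0 < N)%N ->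
  \sum_(1 <= d < N.+1) moebius d * ln (N%:R / d%:R) *
      \sum_(1 <= n < (N %/ d)%N.+1) F (d * n)%N
    = ln N%:R * F 1%N + \sum_(1 <= m < N.+1) mangoldt m * F m.
Proof.
move=> N0.
under eq_bigr => d _ do rewrite big_distrr /=.
rewrite (sum_hyperbola N (fun d m => moebius d * ln (N%:R / d%:R) * F m)).
have E m : (0 < m <= N)%N ->
    \sum_(1 <= d < N.+1 | (d %| m)%N) moebius d * ln (N%:R / d%:R) * F m
    = ((m == 1%N)%:R * ln (N%:R / m%:R) + mangoldt m) * F m.
  move=> mN; have m0 : (0 < m)%N by lia.
  rewrite -big_distrl /= sum_divisors_widen //; congr (_ * _).
  rewrite -sum_moebius_ln // -sum_moebius // big_distrl -big_split /=.
  rewrite big_nat_cond [RHS]big_nat_cond; apply: eq_bigr => d /andP[/andP[d0 _] _].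
  rewrite -mulrDr; congr (_ * _).
  by rewrite -lnM ?posrE ?divr_gt0 ?ltr0n // mulrA divfK // pnatr_eq0 -lt0n.
rewrite big_nat (eq_bigr _ E) -big_nat.
under eq_bigr => d _ do rewrite mulrDl.
rewrite big_split /=; congr (_ + _).
rewrite big_nat_recl //= mul1r divr1 big_nat big1 ?addr0 // => d d1.
by rewrite (_ : (d.+1 == 1)%N = false) ?mul0r //; lia.
Qed.

(** * Elementary estimates for logarithms, factorials and harmonic sums *)

Lemma ln_le_subr1 (x : R) : 0 < x -> ln x <= x - 1.
Proof. by move=> x0; rewrite -{1}(subrKC 1 x) le_ln1Dx //; lra. Qed.

Lemma ln_ge_1subV (x : R) : 0 < x -> 1 - x^-1 <= ln x.
Proof.
move=> x0; have := @ln_le_subr1 x^-1; rewrite invr_gt0 lnV ?posrE //.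
by move=> /(_ x0); lra.
Qed.

Lemma ln_subr_le (x y : R) : 0 < x -> 0 < y -> ln y - ln x <= (y - x) / x.
Proof.
move=> x0 y0; rewrite -ln_div ?posrE // mulrBl divff ?gt_eqF //.
by rewrite ln_le_subr1 // divr_gt0.
Qed.

Lemma lnS_sub_le n : (0 < n)%N -> ln n.+1%:R - ln n%:R <= n%:R^-1 :> R.
Proof.
move=> n0; apply: le_trans (ln_subr_le _ _) _; rewrite ?ltr0n //.
by rewrite -natrB // subSnn mul1r.
Qed.

Lemma lnS_sub_ge n : (0 < n)%N -> n.+1%:R^-1 <= ln n.+1%:R - ln n%:R :> R.
Proof.
move=> n0; have := @ln_subr_le n.+1%:R n%:R; rewrite !ltr0n n0.
move=> /(_ isT isT); rewrite -[(n%:R - _)]opprB -natrB // subSnn mulN1r.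
by rewrite lerNr opprB.
Qed.

Definition lnfact N : R := \sum_(1 <= n < N.+1) ln n%:R.

Lemma lnfact_bounds N : (0 < N)%N ->
  N%:R * ln N%:R - N%:R + 1 <= lnfact N <= N%:R * ln N%:R - N%:R + 1 + ln N%:R.
Proof.
case: N => // N _; elim: N => [|N IH].
  by rewrite /lnfact big_nat1 ln1; lra.
rewrite /lnfact big_nat_recr //= -/(lnfact N.+1).
have N0 : (0 < N.+1%:R :> R) by rewrite ltr0n.
have N0' : (0 < N.+2%:R :> R) by rewrite ltr0n.
have := @lnS_sub_le N.+1 isT; have := @lnS_sub_ge N.+1 isT.
set b := ln N.+2%:R; set a := ln N.+1%:R in IH *.
move=> h1 h2.
have {h1}h1 : 1 <= N.+2%:R * (b - a) by rewrite mulrC -ler_pdivrMr // mul1r.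
have {h2}h2 : N.+1%:R * (b - a) <= 1 by rewrite mulrC -ler_pdivlMr // mul1r.
have E : N.+2%:R = N.+1%:R + 1 :> R by rewrite -natr1.
rewrite E in h1 *; move: IH h1 h2; set x := N.+1%:R => IH h1 h2; apply/andP; split; nra.
Qed.

Definition harmonic N : R := \sum_(1 <= n < N.+1) n%:R^-1.

Lemma euler_gamma : exists2 g : R, 0 <= g <= 1 &
  forall N, (0 < N)%N -> `|harmonic N - ln N%:R - g| <= N%:R^-1.
Proof.
(* [a] decreases, [b] increases, and they differ by [1 / (N + 1)]; Euler's constant is the supremum
   of [b], squeezed between them. *)
pose a N : R := harmonic N.+1 - ln N.+1%:R.
pose b N : R := a N - N.+1%:R^-1.
have aS N : a N.+1 <= a N.
  rewrite /a /harmonic [in X in X <= _]big_nat_recr //=.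
  have := @lnS_sub_ge N.+1 isT; set u := ln _; set v := ln _; set w := _^-1.
  by move: (\sum_(_ <= _ < _) _) => ?; lra.
have bS N : b N <= b N.+1.
  rewrite /b /a /harmonic [in X in _ <= X]big_nat_recr //=.
  have := @lnS_sub_le N.+1 isT; set u := ln _; set v := ln _; set w := _^-1.
  by move: (\sum_(_ <= _ < _) _) (N.+2%:R^-1) => ? ?; lra.
have ba N : b N <= a N by rewrite /b gerBl invr_ge0.
have bmono : {homo b : m n / (m <= n)%N >-> m <= n}.
  by apply: homo_leq => // x y z; apply: le_trans.
have amono : {homo a : m n / (m <= n)%N >-> n <= m}.
  by apply: homo_leq => // x y z h1 h2; apply: le_trans h1.
have bm m n : b m <= a n.
  have [mn|nm] := leqP m n; first exact: le_trans (bmono _ _ mn) (ba _).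
  exact: le_trans (ba _) (amono _ _ (ltnW nm)).
have hs : has_sup (range b).
  by split; [exists (b 0); exists 0|exists (a 0) => _ [m _ <-]].
have sb m : b m <= sup (range b) by apply: ub_le_sup; [exact: hs.2|exists m].
have sa m : sup (range b) <= a m by apply: ge_sup; [exact: hs.1|move=> _ [n _ <-]].
exists (sup (range b)).
  have := sb 0; have := sa 0; rewrite /b /a /harmonic big_nat1 ln1 invr1; lra.
case=> // N _; have := sb N; have := sa N; rewrite /b /a ler_norml.
by move: (harmonic _) (ln _) (_^-1) => ? ? ?; lra.
Qed.

(** * Chebyshev's and Mertens's estimates *)

Definition psiN N : R := \sum_(1 <= n < N.+1) mangoldt n.

Lemma psiN_ge0 N : 0 <= psiN N.
Proof. by apply: sumr_ge0 => i _; exact: mangoldt_ge0. Qed.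

Lemma lnfact_mangoldt N : lnfact N = \sum_(1 <= d < N.+1) mangoldt d * (N %/ d)%:R.
Proof.
transitivity (\sum_(1 <= m < N.+1) \sum_(1 <= d < N.+1 | (d %| m)%N) mangoldt d).
  rewrite /lnfact !big_nat; apply: eq_bigr => m /andP[m0 mN].
  by rewrite sum_divisors_widen ?m0 // sum_mangoldt.
rewrite -(sum_hyperbola N (fun d m => mangoldt d)).
by apply: eq_bigr => d _; rewrite big_const_nat subn1 iter_addr_0 mulr_natr.
Qed.

Lemma lnfact_psiN N : lnfact N = \sum_(1 <= n < N.+1) psiN (N %/ n).
Proof.
rewrite lnfact_mangoldt /psiN.
have W (f : nat -> R) n : (0 < n)%N -> \sum_(1 <= e < (N %/ n)%N.+1) f e =
    \sum_(1 <= e < N.+1 | (e * n <= N)%N) f e.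
  move=> n0; rewrite (big_nat_widen _ _ N.+1) ?ltnS ?leq_div //.
  by apply: eq_bigl => e; rewrite ltnS leq_divRL.
transitivity (\sum_(1 <= d < N.+1) \sum_(1 <= n < (N %/ d)%N.+1) mangoldt d).
  by apply: eq_bigr => d _; rewrite big_const_nat subn1 iter_addr_0 mulr_natr.
transitivity (\sum_(1 <= d < N.+1) \sum_(1 <= n < N.+1 | (n * d <= N)%N) mangoldt d).
  by rewrite !big_nat; apply: eq_bigr => d /andP[d0 _]; exact: W.
rewrite (exchange_big_dep_nat xpredT) //=.
rewrite !big_nat; apply: eq_bigr => d /andP[d0 _]; rewrite W //.
by apply: eq_bigl => e; rewrite mulnC.
Qed.

Lemma ln2_bounds : 2^-1 <= ln (2 : R) <= 9/10.
Proof.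
apply/andP; split; first by have := ln_ge_1subV (ltr0n R 2); lra.
(* The square of 29/20 is 2.1025, just above 2, and [ln (29/20) <= 9/20]. *)
have : ln ((29/20) ^+ 2 : R) <= 9/10.
  by rewrite lnXn; have := @ln_le_subr1 (29/20); lra.
by apply: le_trans; rewrite ler_ln ?posrE; lra.
Qed.

(** In [lnfact N - 2 * lnfact (N %/ 2)] every [mangoldt d] has a nonnegative weight, at least 1 for
    [N %/ 2 < d <= N]. Stirling's bounds make this difference about [N * ln 2]. *)
Lemma psiN_half_le N : (1 < N)%N ->
  psiN N - psiN (N %/ 2) <= 9/10 * N%:R + 3 * ln N%:R + 3.
Proof.
move=> N1; have N0 : (0 < N)%N by lia.
have H : psiN N - psiN (N %/ 2) <= lnfact N - 2 * lnfact (N %/ 2).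
  have W (f : nat -> R) : \sum_(1 <= d < (N %/ 2)%N.+1) f d =
     \sum_(1 <= d < N.+1) (if (d <= N %/ 2)%N then f d else 0).
    rewrite (big_nat_widen _ _ N.+1) ?ltnS ?leq_div // big_mkcond.
    by apply: eq_bigr => d _; rewrite ltnS.
  rewrite !lnfact_mangoldt /psiN !W big_distrr -!sumrB /=.
  apply: ler_sum_nat => d /andP[d0 dN].
  have E : (N %/ 2 %/ d = N %/ d %/ 2)%N by rewrite divnAC.
  have L := mangoldt_ge0 d.
  case: ifP => dN2.
    rewrite E subrr mulrCA -mulrBr mulr_ge0 // subr_ge0 -natrM ler_nat.
    by rewrite mulnC leq_trunc_div.
  by rewrite mulr0 !subr0 ler_peMr // ler1n divn_gt0.
apply: (le_trans H).
have M0 : (0 < N %/ 2)%N by rewrite divn_gt0.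
have /andP[_ hN] := lnfact_bounds N0; have /andP[hM _] := lnfact_bounds M0.
set M := (N %/ 2)%N in M0 hM *.
have MR : 0 < M%:R :> R by rewrite ltr0n.
have l2 := ln2_bounds.
have lMge0 : 0 <= ln (2 * M%:R) :> R by apply: ln_ge0; rewrite -natrM ler1n; lia.
have lN : ln N%:R <= ln (2 * M%:R) + (N%:R - 2 * M%:R) / (2 * M%:R) :> R.
  by rewrite -lerBlDl; apply: ln_subr_le; rewrite ?ltr0n // mulr_gt0.
have e2 : ln (2 * M%:R) = ln 2 + ln M%:R :> R by rewrite lnM ?posrE.
have lNge : ln (2 * M%:R) <= ln N%:R :> R.
  by rewrite ler_ln ?posrE ?ltr0n ?mulr_gt0 // -natrM ler_nat /M; lia.
have NM : N%:R = 2 * M%:R :> R \/ N%:R = 2 * M%:R + 1 :> R.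
  have [|] : N = (2 * M)%N \/ N = (2 * M + 1)%N by rewrite /M; lia.
    by move=> ->; left; rewrite natrM.
  by move=> ->; right; rewrite natrD natrM.
move: NM lN lNge hN hM; set n := N%:R; set m := M%:R in MR lMge0 e2 *.
case=> ->; rewrite ?subrr ?mul0r ?addr0.
  move=> h1 h2.
  by rewrite e2 in lMge0 *; nra.
rewrite [_ + 1 - _]addrAC subrr add0r.
have : 2 * m * (2 * m)^-1 = 1 by rewrite divff //; lra.
set i := (2 * m)^-1; set l := ln (2 * m + 1) => hi h1 h2 h3 h4.
have : 2 * m * l <= 2 * m * ln (2 * m) + 1 by nra.
rewrite e2 in lMge0 h1 h2 *; nra.
Qed.

Lemma ln_le_linear (e : R) : 0 < e ->
  exists2 A : R, 0 <= A & forall x, 0 < x -> ln x <= e * x + A.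
Proof.
move=> e0; exists `|ln e| => // x x0.
have := ln_le_subr1 (mulr_gt0 e0 x0); rewrite lnM ?posrE //.
by have := ler_norm (- ln e); rewrite normrN; lra.
Qed.

Lemma psiN_mono : {homo psiN : m n / (m <= n)%N >-> m <= n}.
Proof.
apply: homo_leq => [//|x y z|N]; first exact: le_trans.
by rewrite [in X in _ <= X]/psiN big_nat_recr //= lerDl mangoldt_ge0.
Qed.

(** Induction by halving: [19/20 * N] from the half and [9/10 * N] from the step leave [N / 20] to
    spare. Of this, 3/100 absorbs [3 * ln N] and 1/50 absorbs [3 * A + 3] beyond [N0]. A slope below
    2 is what matters later. *)
Lemma chebyshev_psiN : exists2 C : R, 0 <= C & forall N, psiN N <= 19/10 * N%:R + C.
Proof.
have [A A0 HA] := @ln_le_linear (1/100) ltac:(lra).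
have [N0 HN0] : exists N0, 50 * (3 * A + 3) <= N0%:R.
  by exists (Num.bound (50 * (3 * A + 3))); rewrite ltW // archi_boundP; lra.
exists (psiN N0 + psiN 1); first by rewrite addr_ge0 // psiN_ge0.
elim/ltn_ind => N IH; have p0 := psiN_ge0 1; have q0 := psiN_ge0 N0.
have NR : 0 <= N%:R :> R by [].
have [NN0|NN0] := leqP N N0; first by have := psiN_mono NN0; lra.
have [N1|N1] := leqP N 1; first by have := psiN_mono N1; lra.
have := psiN_half_le N1; have := IH (N %/ 2)%N ltac:(lia).
have := HA N%:R; rewrite ltr0n (ltnW N1) => /(_ isT).
have : (N %/ 2)%:R <= N%:R / 2 :> R.
  by rewrite ler_pdivlMr // -natrM ler_nat leq_trunc_div.
have : N0%:R <= N%:R :> R by rewrite ler_nat ltnW.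
by move: HN0; move: (psiN N0) (psiN 1) p0 q0 => *; lra.
Qed.

(** By Legendre's formula, [lnfact N] is [N * S] up to a rounding error of at most [psiN N], which
    is O(N); compare with Stirling's bounds and divide by [N]. *)
Lemma mertens_psiN : exists2 C : R, 0 <= C & forall N, (0 < N)%N ->
  `|\sum_(1 <= n < N.+1) mangoldt n / n%:R - ln N%:R| <= C.
Proof.
have [C C0 HC] := chebyshev_psiN; exists (C + 4) => [|N N0]; first by lra.
have NR : 1 <= N%:R :> R by rewrite ler1n.
have /andP[l1 l2] := lnfact_bounds N0.
have lN : ln N%:R <= N%:R :> R by rewrite (le_trans (ln_le_subr1 _)) //; lra.
set S := \sum_(_ <= _ < _) _.
have u : lnfact N <= N%:R * S.
  rewrite lnfact_mangoldt /S big_distrr /=; apply: ler_sum_nat => d /andP[d0 _].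
  rewrite mulrCA ler_wpM2l ?mangoldt_ge0 // ler_pdivlMr ?ltr0n //.
  by rewrite -natrM ler_nat leq_trunc_div.
have v : N%:R * S - psiN N <= lnfact N.
  rewrite lnfact_mangoldt /S big_distrr /= -sumrB; apply: ler_sum_nat => d /andP[d0 _].
  rewrite mulrCA -[X in _ - X <= _]mulr1 -mulrBr ler_wpM2l ?mangoldt_ge0 // lerBlDr.
  by rewrite ler_pdivrMr ?ltr0n // natr1 -natrM ler_nat ltnW // ltn_ceil.
have hC := HC N; have CN : C <= N%:R * C by rewrite ler_peMl.
rewrite ler_norml; have h1 : N%:R * (ln N%:R - 1) <= N%:R * S by lra.
have h2 : N%:R * S <= N%:R * (ln N%:R + C + 3) by nra.
by move: h1 h2; rewrite !ler_pM2l; lra.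
Qed.

(** * Selberg's formula *)

Lemma sum_sqrtV_le N :
  \sum_(1 <= d < N.+1) (Num.sqrt d%:R)^-1 <= 2 * Num.sqrt N%:R :> R.
Proof.
elim: N => [|N IH]; first by rewrite big_geq // sqrtr0 mulr0.
rewrite big_nat_recr //=; apply: (le_trans (lerD IH (lexx _))).
set x : R := Num.sqrt N%:R; set y : R := Num.sqrt N.+1%:R.
have x0 : 0 <= x by apply: sqrtr_ge0.
have y0 : 0 < y by rewrite sqrtr_gt0 ltr0n.
have E : y ^+ 2 = x ^+ 2 + 1 by rewrite !sqr_sqrtr // natr1.
have : y * y^-1 = 1 by rewrite divff // gt_eqF.
have : 0 <= (x - y) ^+ 2 by exact: sqr_ge0.
by move: (y^-1) => i h h'; rewrite -(ler_pM2l y0); nra.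
Qed.

Lemma ln_mul_le_sqrt (t : R) : 1 <= t -> ln t * (4 + ln t) <= 32 * Num.sqrt t.
Proof.
(* With the fourth root [s], [ln t = 4 * ln s <= 4 * (s - 1)], so the left side is at most quadratic
   in [s]. *)
move=> t1; set s := Num.sqrt (Num.sqrt t).
have s1 : 1 <= s by rewrite -sqrtr1 !ler_sqrt ?sqrtr_ge0 // -{1}sqrtr1 ler_sqrt; lra.
have E : s ^+ 2 = Num.sqrt t by rewrite sqr_sqrtr // sqrtr_ge0.
have Et : t = s ^+ 4 by rewrite (exprM s 2 2) E sqr_sqrtr; lra.
have -> : ln t = 4 * ln s by rewrite [in LHS]Et lnXn; [rewrite mulr_natl|lra].
have : ln s <= s - 1 by apply: ln_le_subr1; lra.
have : 0 <= ln s by exact: ln_ge0.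
rewrite -E; move: (ln s) => l; nra.
Qed.

Lemma selberg_psiN : exists2 C : R, 0 <= C & forall N, (0 < N)%N ->
  `|psiN N * ln N%:R + \sum_(1 <= m < N.+1) mangoldt m * psiN (N %/ m)
     - 2 * N%:R * ln N%:R| <= C * N%:R.
Proof.
have [g g01 Hg] := euler_gamma.
have [Cc Cc0 Hc] := chebyshev_psiN.
have [Cm Cm0 Hm] := mertens_psiN.
exists (64 + Cm + 2 + 2 * (Cc + 2)) => [|N N0]; first by lra.
have NR : 1 <= N%:R :> R by rewrite ler1n.
have NR0 : 0 < N%:R :> R by lra.
(* The constant [1 + g] is chosen so that the terms of order [M * ln M] and [M] from Stirling's
   bounds and the harmonic sum cancel in the inner sums, leaving only a logarithm. *)
pose F m : R := psiN (N %/ m) - N%:R / m%:R + (1 + g).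
have inner d : (0 < d <= N)%N ->
  `|\sum_(1 <= n < (N %/ d)%N.+1) F (d * n)%N| <= 4 + ln (N%:R / d%:R).
  move=> /andP[d0 dN]; set M := (N %/ d)%N; set t : R := N%:R / d%:R.
  have M0 : (0 < M)%N by rewrite divn_gt0.
  have dR : 0 < d%:R :> R by rewrite ltr0n.
  have MR : 1 <= M%:R :> R by rewrite ler1n.
  have Mt : M%:R <= t by rewrite ler_pdivlMr // -natrM ler_nat leq_trunc_div.
  have tM : t <= M%:R + 1.
    by rewrite ler_pdivrMr // natr1 -natrM ler_nat ltnW // ltn_ceil.
  have -> : \sum_(1 <= n < M.+1) F (d * n)%N =
     lnfact M - t * harmonic M + (1 + g) * M%:R.
    rewrite /F big_split big_split /= sumrN lnfact_psiN.
    congr (_ - _ + _).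
    - by rewrite !big_nat; apply: eq_bigr => n _; rewrite divnMA.
    - rewrite /harmonic big_distrr /= !big_nat; apply: eq_bigr => n _.
      by rewrite natrM invfM mulrA.
    - by rewrite big_const_nat subn1 iter_addr_0 mulr_natr.
  have lMt : ln M%:R <= ln t by rewrite ler_ln ?posrE //; lra.
  have lM : 0 <= ln M%:R :> R by exact: ln_ge0.
  have := lnfact_bounds M0; have := Hg _ M0; rewrite ler_norml.
  set i := M%:R^-1; have iM : M%:R * i = 1 by rewrite divff //; lra.
  have i0 : 0 < i by rewrite invr_gt0; lra.
  have i1 : i <= 1 by rewrite invf_le1; lra.
  move: (ln t) lMt => lnt; move: (harmonic M) (lnfact M) (ln M%:R) lM => H f l l0 lt.
  move: {i}(i) M%:R i0 i1 iM MR Mt tM => i m i0 i1 im m1 mt tm Hh Hf.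
  pose z := H - l - g; have z1 : - i <= z <= i by rewrite /z; lra.
  have -> : H = l + g + z by rewrite /z; lra.
  have ti : t * i <= 2 by nra.
  have tz1 : t * z <= 2 by nra.
  have tz2 : - 2 <= t * z by nra.
  rewrite ler_norml; apply/andP; split; nra.
have := tatuzawa_iseki F N0; set L := \sum_(_ <= _ < _) _ => TI.
(* The error at [d] is of order [sqrt (N / d)], and these errors add up to O(N). *)
have HL : `|L| <= 64 * N%:R.
  rewrite /L; apply: (le_trans (ler_norm_sum _ _ _)).
  apply: (@le_trans _ _ (\sum_(1 <= d < N.+1) 32 * Num.sqrt N%:R * (Num.sqrt d%:R)^-1)).
    apply: ler_sum_nat => d /andP[d0 dN].
    have dR : 0 < d%:R :> R by rewrite ltr0n.
    have t1 : 1 <= N%:R / d%:R :> R by rewrite ler_pdivlMr // mul1r ler_nat.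
    have l0 := ln_ge0 t1.
    rewrite 2!normrM -mulrA; apply: (@le_trans _ _ (1 * (ln (N%:R / d%:R) * (4 + ln (N%:R / d%:R))))).
      rewrite ler_pM ?mulr_ge0 ?normr_moebius_le1 // [`|ln _|]ger0_norm //.
      by rewrite ler_wpM2l // inner // d0.
    by rewrite mul1r (le_trans (ln_mul_le_sqrt t1)) // sqrtrM ?sqrtrV ?mulrA.
  rewrite -big_distrr /=; have := sum_sqrtV_le N.
  have : Num.sqrt N%:R ^+ 2 = N%:R :> R by rewrite sqr_sqrtr.
  have : 0 <= Num.sqrt N%:R :> R by exact: sqrtr_ge0.
  by move: (\sum_(_ <= _ < _) _) (Num.sqrt _) => *; nra.
have E : \sum_(1 <= m < N.+1) mangoldt m * F m =
   \sum_(1 <= m < N.+1) mangoldt m * psiN (N %/ m)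
   - N%:R * \sum_(1 <= m < N.+1) mangoldt m / m%:R + (1 + g) * psiN N.
  rewrite [X in _ + _ * X]/psiN !big_distrr /= -sumrB -big_split /=.
  by apply: eq_bigr => m _; rewrite /F; ring.
(* Mertens's estimate replaces [S2] by [ln N]; the terms with [1 + g] are O(N), by Chebyshev's bound
   for [psiN N]. *)
move: TI HL (Hm N N0); rewrite {}E /F divn1 divr1.
have lN0 : 0 <= ln N%:R :> R by exact: ln_ge0.
have lN : ln N%:R <= N%:R :> R by rewrite (le_trans (ln_le_subr1 _)) //; lra.
have := Hc N; have := psiN_ge0 N.
move: (\sum_(_ <= _ < _) _ * psiN _) (\sum_(_ <= _ < _) _ / _) => S1 S2.
move: (psiN N) (ln N%:R) lN0 lN => p l l0.
move: N%:R NR {NR0} => n n1 lN p0 pC -> h1 h2.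
have : `|n * (S2 - l)| <= n * Cm.
  by rewrite normrM ger0_norm ?ler_wpM2l //; lra.
have : 0 <= (1 + g) * l <= 2 * n by apply/andP; split; nra.
have : 0 <= (1 + g) * p <= 2 * (19/10 * n + Cc) by apply/andP; split; nra.
have : Cc <= Cc * n by rewrite ler_peMr.
have -> : p * l + S1 - 2 * n * l =
  (l * (p - n + (1 + g)) + (S1 - n * S2 + (1 + g) * p)) - (1 + g) * l
    - (1 + g) * p + n * (S2 - l) by ring.
move: h1; rewrite !ler_norml; move: (l * _ + _) => X; move: (n * (S2 - l)) => Y.
by move: ((1 + g) * p) ((1 + g) * l) => *; lra.
Qed.
End ArithmeticFunctions.

(** * Prime powers in short intervals *)

Section PrimePowerGaps.
Variable R : realType.
Local Notation mangoldt := (@mangoldt R).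
Local Notation psiN := (@psiN R).
Implicit Types (x y z w t : R) (n N : nat).

Definition psi x : R := psiN (Num.truncn x).

Lemma psi_ge0 x : 0 <= psi x. Proof. exact: psiN_ge0. Qed.

Lemma psi_mono x y : x <= y -> psi x <= psi y.
Proof. by move=> xy; apply/psiN_mono/le_truncn. Qed.

Lemma psi_lt1 x : x < 1 -> psi x = 0.
Proof.
move=> x1; rewrite /psi (_ : Num.truncn x = 0%N); last by apply/truncn0Pn; rewrite -ltNge.
exact: big_geq.
Qed.

Lemma truncn_divn x n : 0 <= x -> (0 < n)%N ->
  Num.truncn (x / n%:R) = (Num.truncn x %/ n)%N.
Proof.
move=> x0 n0; have nR : 0 < n%:R :> R by rewrite ltr0n.
apply: truncn_def; have /andP[h1 h2] := truncn_itv x0.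
rewrite ler_pdivlMr // ltr_pdivrMr // -!natrM; apply/andP; split.
  by apply: le_trans h1; rewrite ler_nat leq_trunc_div.
by apply: lt_le_trans h2 _; rewrite ler_nat ltn_ceil.
Qed.

(* The sum of [f n] over the [n] with [x < n <= y], for [0 <= x]. *)
Definition isum x y (f : nat -> R) : R :=
  \sum_((Num.truncn x).+1 <= n < (Num.truncn y).+1) f n.

Lemma isum_cat x y z f : x <= y -> y <= z -> isum x z f = isum x y f + isum y z f.
Proof. by move=> xy yz; rewrite /isum -big_cat_nat // ltnS le_truncn. Qed.

Lemma isum_itv x n y : 0 <= x -> ((Num.truncn x).+1 <= n < (Num.truncn y).+1)%N ->
  x < n%:R <= y.
Proof.
move=> x0 /andP[h1 h2]; rewrite -truncn_lt_nat // h1 /=.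
have [y0|y0] := leP 0 y; first by rewrite -truncn_ge_nat.
have : Num.truncn y = 0%N by apply/truncn0Pn; lra.
by lia.
Qed.

Lemma ler_isum x y f g : 0 <= x ->
  (forall n, x < n%:R <= y -> f n <= g n) -> isum x y f <= isum x y g.
Proof. by move=> x0 h; apply: ler_sum_nat => n /(isum_itv x0) /h. Qed.

Lemma eq_isum x y f g : 0 <= x ->
  (forall n, x < n%:R <= y -> f n = g n) -> isum x y f = isum x y g.
Proof.
by move=> x0 h; rewrite /isum !big_nat; apply: eq_bigr => n /(isum_itv x0) /h.
Qed.

Lemma isum_ge0 x y f : 0 <= x ->
  (forall n, x < n%:R <= y -> 0 <= f n) -> 0 <= isum x y f.
Proof.
by move=> x0 h; rewrite /isum big_nat; apply: sumr_ge0 => n /(isum_itv x0) /h.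
Qed.

Lemma isumZ x y (a : R) f : isum x y (fun n => a * f n) = a * isum x y f.
Proof. by rewrite /isum big_distrr. Qed.

Lemma isumD x y f g : isum x y (fun n => f n + g n) = isum x y f + isum x y g.
Proof. by rewrite /isum big_split. Qed.

Lemma isumB x y f g : isum x y (fun n => f n - g n) = isum x y f - isum x y g.
Proof. by rewrite /isum sumrB. Qed.

Lemma psi_isum x y : 0 <= x -> x <= y -> psi y - psi x = isum x y mangoldt.
Proof.
move=> x0 xy; apply/eqP; rewrite subr_eq addrC; apply/eqP.
have := isum_cat mangoldt x0 xy; rewrite {1 2}/isum truncn0.
by [].
Qed.

Lemma chebyshev : exists2 C : R, 0 <= C & forall x, 0 <= x -> psi x <= 19/10 * x + C.
Proof.
have [C C0 H] := @chebyshev_psiN R; exists C => // x x0.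
apply: le_trans (H _) _; rewrite lerD2r ler_wpM2l ?truncn_le //.
Qed.

Lemma psi_le_linear : exists2 C : R, 0 <= C & forall x, 0 <= x -> psi x <= C * x.
Proof.
have [C C0 H] := chebyshev; exists (2 + C) => [|x x0]; first by lra.
have [x1|x1] := ltP x 1; first by rewrite psi_lt1 // mulr_ge0 //; lra.
by apply: le_trans (H _ x0) _; nra.
Qed.

Lemma mertens : exists2 C : R, 0 <= C & forall x, 1 <= x ->
  `|isum 0 x (fun n => mangoldt n / n%:R) - ln x| <= C.
Proof.
have [C C0 H] := @mertens_psiN R; exists (C + 1) => [|x x1]; first by lra.
have /andP[h1 h2] : (Num.truncn x)%:R <= x < (Num.truncn x).+1%:R by apply: truncn_itv; lra.
rewrite /isum truncn0; set N := Num.truncn x in h1 h2 *.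
have N0 : (0 < N)%N by rewrite truncn_gt0.
have NR : 1 <= N%:R :> R by rewrite ler1n.
have : ln x - ln N%:R <= 1.
  apply: le_trans (ln_subr_le _ _) _; try lra.
  by rewrite ler_pdivrMr; move: h2; rewrite -natr1; lra.
have : ln N%:R <= ln x by rewrite ler_ln ?posrE; lra.
by have := H N N0; rewrite !ler_norml; lra.
Qed.

Lemma selberg : exists2 C : R, 0 <= C & forall x, 1 <= x ->
  `|psi x * ln x + isum 0 x (fun n => mangoldt n * psi (x / n%:R)) - 2 * x * ln x|
    <= C * x.
Proof.
have [C C0 H] := @selberg_psiN R.
have [D D0 HD] := psi_le_linear.
exists (C + D + 4) => [|x x1]; first by lra.
have x0 : 0 <= x by lra.
have /andP[h1 h2] := truncn_itv x0.
have -> : isum 0 x (fun n => mangoldt n * psi (x / n%:R)) =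
   \sum_(1 <= m < (Num.truncn x).+1) mangoldt m * psiN (Num.truncn x %/ m).
  rewrite /isum truncn0 !big_nat; apply: eq_bigr => n /andP[n0 _].
  by rewrite /psi truncn_divn.
rewrite /psi; set N := Num.truncn x in h1 h2 *.
have N0 : (0 < N)%N by rewrite truncn_gt0.
have NR : 1 <= N%:R :> R by rewrite ler1n.
have hx : x - N%:R <= 1 by move: h2; rewrite -natr1; lra.
have lx0 : 0 <= ln N%:R :> R by exact: ln_ge0.
have lxx : ln x <= x by apply: le_trans (ln_le_subr1 _) _; lra.
have l1 : (ln x - ln N%:R) * N%:R <= 1.
  have := @ln_subr_le R N%:R x ltac:(lra) ltac:(lra).
  by rewrite ler_pdivlMr; [move=> /le_trans; apply|]; lra.
have l2 : ln N%:R <= ln x by rewrite ler_ln ?posrE; lra.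
have p0 := @psiN_ge0 R N.
have p1 : psiN N <= D * N%:R.
  by have := HD N%:R; rewrite /psi natrK; apply; lra.
have := H N N0; set S := \sum_(_ <= _ < _) _; rewrite !ler_norml.
have q1 : 0 <= psiN N * (ln x - ln N%:R) by rewrite mulr_ge0 //; lra.
have q2 : psiN N * (ln x - ln N%:R) <= D.
  apply: (@le_trans _ _ (D * N%:R * (ln x - ln N%:R))).
    by rewrite ler_wpM2r //; lra.
  by nra.
have q3 : 0 <= x * ln x - N%:R * ln N%:R by nra.
have q4 : x * ln x - N%:R * ln N%:R <= 2 * x by nra.
move: q1 q2 q3 q4; move: (psiN N) (ln x) (ln N%:R) => p l l'.
by move: N%:R NR h1 => n *; apply/andP; split; nra.
Qed.

(** Selberg's formula at [y] minus that at [x]. The sum for [x] may run up to [y], as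
    [psi (x / n) = 0] for [n > x]. *)
Lemma selberg_diff : exists2 C : R, 0 <= C & forall x y, 1 <= x -> x <= y ->
  `|(psi y - psi x) * ln y + psi x * (ln y - ln x)
    + isum 0 y (fun n => mangoldt n * (psi (y / n%:R) - psi (x / n%:R)))
    - 2 * (y - x) * ln y - 2 * x * (ln y - ln x)| <= C * y.
Proof.
have [C C0 H] := selberg; exists (2 * C) => [|x y x1 xy]; first by lra.
have -> : isum 0 y (fun n => mangoldt n * (psi (y / n%:R) - psi (x / n%:R))) =
   isum 0 y (fun n => mangoldt n * psi (y / n%:R)) -
   isum 0 x (fun n => mangoldt n * psi (x / n%:R)).
  under eq_fun do rewrite mulrBr.
  rewrite isumB; congr (_ - _).
  rewrite (@isum_cat 0 x y) //; last by lra.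
  rewrite [X in _ + X](_ : _ = 0) ?addr0 //.
  rewrite -[RHS](mul0r (isum x y (fun=> 0))) -isumZ.
  apply: eq_isum => [|n /andP[xn ny]]; first by lra.
  by rewrite psi_lt1 ?mulr0 // ltr_pdivrMr ?mul1r //; lra.
have := H x x1; have := H y ltac:(lra).
have : C * x <= C * y by rewrite ler_wpM2l.
by rewrite !ler_norml => *; lra.
Qed.

Definition psi_deficit x : R := 2 * x - psi x.

(** The sum in [selberg_diff] is nonnegative, so [psi] gains at most [2 * (y - x) + O(y / ln y)].
    The extreme density 2 explains the 2 in [psi_deficit]. *)
Lemma psi_deficit_almost_mono (eta : R) : 0 < eta ->
  exists2 Z : R, 1 <= Z & forall x y, Z <= x -> x <= y -> psi_deficit x - psi_deficit y <= eta * y.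
Proof.
move=> e0; have [C C0 H] := selberg_diff; set c := (C + 2) / eta.
(* This threshold forces [ln y >= (C + 2) / eta]. *)
exists (1 + expR c) => [|x y Zx xy]; first by have := expR_gt0 c; lra.
have ec := expR_gt0 c.
have x1 : 1 <= x by lra.
have ly : c <= ln y by rewrite -[c]expRK ler_ln ?posrE //; lra.
have ly0 : 0 < ln y by apply: lt_le_trans ly; rewrite divr_gt0 //; lra.
have lxy : 0 <= ln y - ln x by rewrite subr_ge0 ler_ln ?posrE //; lra.
have lxy1 : x * (ln y - ln x) <= y - x.
  by rewrite mulrC -ler_pdivlMr; [apply: ln_subr_le|]; lra.
have p0 : 0 <= psi x * (ln y - ln x) by rewrite mulr_ge0 // psi_ge0.
have s0 : 0 <= isum 0 y (fun n => mangoldt n * (psi (y / n%:R) - psi (x / n%:R))).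
  apply: isum_ge0 => // n _; rewrite mulr_ge0 ?mangoldt_ge0 // subr_ge0 psi_mono //.
  by rewrite ler_wpM2r // invr_ge0.
have := H x y x1 xy; rewrite ler_norml => /andP[_ h].
have {}h : (psi_deficit x - psi_deficit y) * ln y <= (C + 2) * y by rewrite /psi_deficit; nra.
rewrite -(ler_pM2r ly0); apply: le_trans h _.
have : C + 2 <= eta * ln y by rewrite mulrC -ler_pdivrMr.
by move=> ?; rewrite -mulrA [y * _]mulrC mulrA ler_wpM2r //; lra.
Qed.

(** Mertens's estimate spreads the main term [2 * (y - x) * ln y] over the [n] with weights
    [mangoldt n / n], where it merges with the differences of [psi] into deficits. *)
Lemma weighted_deficit : exists2 C : R, 0 <= C & forall x y, 1 <= x -> x <= y ->
  isum 0 y (fun n => mangoldt n * (psi_deficit (y / n%:R) - psi_deficit (x / n%:R)))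
    <= (psi y - psi x) * ln y + C * y.
Proof.
have [C C0 H] := selberg_diff; have [D D0 HD] := psi_le_linear.
have [E E0 HE] := mertens.
exists (C + D + 2 * E) => [|x y x1 xy]; first by lra.
have -> : isum 0 y (fun n => mangoldt n * (psi_deficit (y / n%:R) - psi_deficit (x / n%:R))) =
  2 * (y - x) * isum 0 y (fun n => mangoldt n / n%:R)
  - isum 0 y (fun n => mangoldt n * (psi (y / n%:R) - psi (x / n%:R))).
  rewrite -isumZ -isumB; apply: eq_isum => // n _; rewrite /psi_deficit; ring.
have lxy : 0 <= ln y - ln x by rewrite subr_ge0 ler_ln ?posrE //; lra.
have lxy1 : x * (ln y - ln x) <= y - x.
  by rewrite mulrC -ler_pdivlMr; [apply: ln_subr_le|]; lra.
have p1 : psi x * (ln y - ln x) <= D * y.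
  apply: (@le_trans _ _ (D * x * (ln y - ln x))).
    by rewrite ler_wpM2r // HD //; lra.
  by rewrite -mulrA ler_wpM2l //; lra.
have := H x y x1 xy; rewrite ler_norml => /andP[h _].
have := HE y ltac:(lra); rewrite ler_norml => /andP[_ h'].
have : 2 * (y - x) * (isum 0 y (fun n => mangoldt n / n%:R) - ln y) <= 2 * y * E.
  apply: (@le_trans _ _ (2 * (y - x) * E)); first by rewrite ler_wpM2l //; lra.
  by rewrite ler_wpM2r //; lra.
have : 0 <= x * (ln y - ln x) by rewrite mulr_ge0 //; lra.
by move: h p1; rewrite !mulrDl; move: (isum _ _ _) (isum _ _ _) => *; lra.
Qed.

(** * Bad ratios and geometric windows *)

Lemma geometric_bracket (K a x : R) : 1 < K -> 0 < a -> a <= x ->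
  exists J : nat, a * K ^+ J <= x < a * K ^+ J.+1.
Proof.
move=> K1 a0 ax.
have ex : exists j : nat, x < a * K ^+ j.
  (* This exponent works by Bernoulli's inequality [1 + j * (K - 1) <= K ^+ j]. *)
  exists (Num.bound (x / a / (K - 1))); set j := Num.bound _.
  rewrite mulrC -ltr_pdivrMr //; apply: (@lt_le_trans _ _ (1 + j%:R * (K - 1))).
    have : x / a / (K - 1) < j%:R by apply: archi_boundP; rewrite !divr_ge0 //; lra.
    by rewrite ltr_pdivrMr; lra.
  elim: j => [|j IH]; first by rewrite mul0r addr0 expr0.
  have : 0 <= j%:R :> R by [].
  rewrite exprS -natr1; move: (j%:R) (K ^+ j) IH => u v *.
  apply: (@le_trans _ _ (K * (1 + u * (K - 1)))); last by rewrite ler_wpM2l //; lra.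
  have : 0 <= u * (K - 1) ^+ 2 by rewrite mulr_ge0 // sqr_ge0.
  by lra.
case: (ex_minnP ex) => -[|j] h1 h2; first by move: h1; rewrite expr0; lra.
exists j; rewrite h1 andbT leNgt; apply/negP => /h2; lia.
Qed.

Lemma isum_geometric (K a : R) (J : nat) f : 1 < K -> 0 < a ->
  isum a (a * K ^+ J) f = \sum_(j < J) isum (a * K ^+ j) (a * K ^+ j.+1) f.
Proof.
move=> K1 a0; elim: J => [|J IH].
  by rewrite big_ord0 /isum expr0 mulr1 big_geq.
rewrite big_ord_recr /= -IH -isum_cat //.
- by rewrite ler_peMr ?exprn_ege1; lra.
- by rewrite ler_wpM2l ?ler_weXn2l //; lra.
Qed.

(** This encodes [psi (L * x) - psi x = o(x)] along some sequence of [x] tending to infinity. *)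
Definition bad_ratio (L : R) := forall d X : R, 0 < d ->
  exists2 x, X <= x & psi (L * x) - psi x <= d * x.

(** This is [weighted_deficit] for [x] and [L * x]. The added [eta * L * x / n] will make the
    summands nonnegative, by almost monotonicity, and costs about [eta * L * x * ln x]; the [n]
    beyond [x / Z] matter only O(x), by Mertens's estimate. *)
Lemma deficit_total (L eta Z : R) : 1 < L -> 0 < eta -> 1 <= Z ->
  exists C5 : R, forall x, Z <= x -> psi (L * x) - psi x <= eta * x ->
    isum 0 (x / Z) (fun n => mangoldt n *
      (psi_deficit (L * x / n%:R) - psi_deficit (x / n%:R) + eta * L * x / n%:R))
    <= (1 + L) * eta * x * ln x + C5 * x.
Proof.
move=> L1 e0 Zge1.
have [C C0 HC] := weighted_deficit.
have [D D0 HD] := psi_le_linear.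
have [E E0 HE] := mertens.
have lL : 0 < ln L by exact: ln_gt0.
have lZ : 0 <= ln Z by exact: ln_ge0.
pose C5 := eta * ln L + C * L + D * L * (ln L + ln Z + 2 * E) + eta * L * E.
exists C5 => x Zx xd; have x1 : 1 <= x by lra.
have xZ1 : 1 <= x / Z by rewrite ler_pdivlMr ?mul1r //; lra.
have xZx : x / Z <= x by rewrite ler_pdivrMr; nra.
have xLx : x <= L * x by nra.
have S1 := HC x (L * x) x1 xLx.
have lLx : ln (L * x) = ln L + ln x by rewrite lnM ?posrE; lra.
have lxZ : ln (x / Z) = ln x - ln Z by rewrite ln_div ?posrE; lra.
have M1 := HE (L * x) ltac:(lra); have M2 := HE (x / Z) ltac:(lra).
have lx : ln (x / Z) <= ln x by lra.
have S2 : isum 0 (x / Z) (fun n => mangoldt n *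
    (psi_deficit (L * x / n%:R) - psi_deficit (x / n%:R) + eta * L * x / n%:R)) =
  isum 0 (x / Z) (fun n => mangoldt n * (psi_deficit (L * x / n%:R) - psi_deficit (x / n%:R)))
  + eta * L * x * isum 0 (x / Z) (fun n => mangoldt n / n%:R).
  by rewrite -isumZ -isumD; apply: eq_isum => // n _; ring.
have S3 : - (D * (L * x) * isum (x / Z) (L * x) (fun n => mangoldt n / n%:R)) <=
  isum (x / Z) (L * x) (fun n => mangoldt n * (psi_deficit (L * x / n%:R) - psi_deficit (x / n%:R))).
  rewrite -mulNr -isumZ; apply: ler_isum => [|n /andP[n1 n2]]; first by lra.
  have n0 : 0 < n%:R :> R by lra.
  rewrite mulrCA ler_wpM2l ?mangoldt_ge0 //.
  have h1 := HD (L * x / n%:R) ltac:(apply: divr_ge0; lra).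
  have h2 := psi_ge0 (x / n%:R).
  have h3 : x / n%:R <= L * x / n%:R by rewrite ler_pM2r ?invr_gt0.
  have -> : - (D * (L * x)) / n%:R = - (D * (L * x / n%:R)) by ring.
  by rewrite /psi_deficit; move: (x / n%:R) (L * x / n%:R) h1 h2 h3 => *; lra.
have := isum_cat (fun n => mangoldt n / n%:R) (_ : 0 <= x / Z) (_ : x / Z <= L * x).
move=> /(_ ltac:(lra) ltac:(lra)) cat1.
have := isum_cat (fun n => mangoldt n * (psi_deficit (L * x / n%:R) - psi_deficit (x / n%:R)))
   (_ : 0 <= x / Z) (_ : x / Z <= L * x).
move=> /(_ ltac:(lra) ltac:(lra)) cat2.
move: M1 M2; rewrite cat1 !ler_norml lLx lxZ => M1 M2.
rewrite {}cat2 in S1; rewrite {}S2.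
move: S1 S3 M1 M2; rewrite lLx.
set I1 := isum _ _ _; set I2 := isum _ _ _; set I3 := isum _ _ _; set I4 := isum _ _ _.
move=> S1 S3 M1 M2.
have q1 : D * (L * x) * I3 <= D * (L * x) * (ln L + ln Z + 2 * E).
  by rewrite ler_wpM2l ?mulr_ge0 //; lra.
have q2 : eta * L * x * I4 <= eta * L * x * (ln x + E).
  by rewrite ler_wpM2l ?mulr_ge0 //; lra.
have q3 : (psi (L * x) - psi x) * (ln L + ln x) <= eta * x * (ln L + ln x).
  by rewrite ler_wpM2r //; have := ln_ge0 x1; lra.
by rewrite /C5; lra.
Qed.

(** Pigeonhole: about [ln x / ln K] windows [(w, K * w]] share the total of [deficit_total], so one
    of them gets at most about twice the average. *)
Lemma sparse_window (L K eta Z0 W0 : R) : 1 < L -> bad_ratio L -> 1 < K ->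
  0 < eta ->
  exists x w, [/\ W0 <= w, 1 <= w, K * w * Z0 <= x & isum w (K * w) (fun n =>
    mangoldt n * (psi_deficit (L * x / n%:R) - psi_deficit (x / n%:R) + eta * L * x / n%:R))
    <= 2 * (1 + L) * eta * ln K * x].
Proof.
move=> L1 bad K1 e0.
have [Z1 Z11 HZ1] := psi_deficit_almost_mono e0.
set Z := Num.max Z1 Z0.
have Z1Z : Z1 <= Z by rewrite le_max lexx.
have Z0Z : Z0 <= Z by rewrite le_max lexx orbT.
have Zge1 : 1 <= Z by lra.
pose W := Num.max 1 W0.
have W1 : 1 <= W by rewrite le_max lexx.
have W0W : W0 <= W by rewrite le_max lexx orbT.
have [C5 HC5] := deficit_total L1 e0 Zge1.
have lK : 0 < ln K by exact: ln_gt0.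
pose c := (1 + L) * eta * ln K.
have c0 : 0 < c by rewrite /c !mulr_gt0 //; lra.
(* [C6] collects the errors independent of [x]; with more than [J0] windows, the factor 2 absorbs
   it. *)
pose C6 := c + (1 + L) * eta * ln (W * Z) + C5.
have [J0 HJ0] : exists J0 : nat, C6 / c < J0%:R.
  exists (Num.bound (C6 / c)); have [h|h] := leP 0 (C6 / c); first exact: archi_boundP.
  by apply: lt_le_trans h _.
have Wgt0 : 0 < W by lra.
have Zgt0 : 0 < Z by lra.
have Kge1 : 1 <= K by exact: ltW.
have Lgt0 : 0 < 1 + L by lra.
have WZ0 : 0 < W * Z by rewrite mulr_gt0.
have K0 : 0 < K by lra.
have KJ j : 0 < K ^+ j by exact: exprn_gt0.
have [x Xx xd] := bad eta (W * Z * K ^+ J0.+1) e0.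
have WZ1 : 1 <= W * Z by exact: mulr_ege1.
have xWZ : W * Z <= x.
  by apply: le_trans Xx; rewrite ler_peMr ?exprn_ege1 //; lra.
have Zx : Z <= x by apply: le_trans xWZ; rewrite ler_peMl //; lra.
have [J /andP[J1 J2]] := geometric_bracket K1 WZ0 xWZ.
have J0J : (J0.+1 < J.+1)%N.
  by rewrite -(@ltr_eXn2l _ K) // -(ltr_pM2l WZ0) (le_lt_trans Xx J2).
have hJ : C6 < c * J%:R.
  rewrite mulrC -ltr_pdivrMr //; apply: (lt_le_trans HJ0).
  by rewrite ler_nat ltnW.
pose A n := mangoldt n * (psi_deficit (L * x / n%:R) - psi_deficit (x / n%:R) + eta * L * x / n%:R).
have x1 : 1 <= x by lra.
have WZx : W * K ^+ J <= x / Z by rewrite ler_pdivlMr; [rewrite mulrAC|lra].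
have xZx : x / Z <= x by rewrite ler_pdivrMr; nra.
have xLx : x <= L * x by nra.
have xZ1 : 1 <= x / Z.
  by apply: le_trans WZx; rewrite -[X in X <= _]mulr1 ler_pM ?exprn_ege1 //; lra.
have A0 n : (0 : R) < n%:R <= x / Z -> 0 <= A n.
  move=> /andP[n0 nx]; rewrite /A mulr_ge0 ?mangoldt_ge0 //.
  have h1 : Z1 <= x / n%:R.
    rewrite ler_pdivlMr //; move: nx; rewrite ler_pdivlMr; last by lra.
    by move=> ?; apply: (@le_trans _ _ (Z * n%:R)); [rewrite ler_wpM2r //|]; lra.
  have h2 : x / n%:R <= L * x / n%:R by rewrite ler_pM2r ?invr_gt0.
  by have := HZ1 _ _ h1 h2; rewrite !mulrA; lra.
have total := HC5 x Zx xd; rewrite -/A in total.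
have lx : ln x <= J.+1%:R * ln K + ln (W * Z).
  have <- : ln (W * Z * K ^+ J.+1) = J.+1%:R * ln K + ln (W * Z).
    by rewrite lnM ?posrE // lnXn // mulr_natl addrC.
  rewrite ler_ln ?posrE ?mulr_gt0 ?ltW //.
  exact: lt_le_trans Zx.
have win : isum W (W * K ^+ J) A <= c * J%:R * x + C6 * x.
  apply: (@le_trans _ _ (isum 0 (x / Z) A)).
    have WJ : W <= W * K ^+ J by rewrite ler_peMr ?exprn_ege1 // ltW.
    rewrite (@isum_cat 0 (W * K ^+ J)) //; last by lra.
    rewrite (@isum_cat 0 W) //; try lra.
    have : 0 <= isum 0 W A.
      by apply: isum_ge0 => // n /andP[n1 n2]; apply: A0; lra.
    have : 0 <= isum (W * K ^+ J) (x / Z) A.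
      apply: isum_ge0 => [|n /andP[n1 n2]]; first by lra.
      by apply: A0; lra.
    by lra.
  apply: (le_trans total).
  have : (1 + L) * eta * x * ln x <= (1 + L) * eta * x * (J.+1%:R * ln K + ln (W * Z)).
    by rewrite ler_wpM2l // !mulr_ge0 // ?ltW //; lra.
  by rewrite /C6 /c -natr1; lra.
have [j jJ] : exists2 j, (j < J)%N & isum (W * K ^+ j) (W * K ^+ j.+1) A <= 2 * c * x.
  apply: contrapT => no.
  have : \sum_(j < J) 2 * c * x <= isum W (W * K ^+ J) A.
    rewrite isum_geometric //.
    by apply: ler_sum => j _; rewrite leNgt; apply/negP => h; apply: no; exists j => //; apply: ltW.
  rewrite sumr_const card_ord -[_ *+ J]mulr_natr; nra.
move=> hj; exists x, (W * K ^+ j); have KJ1 : 1 <= K ^+ j by exact: exprn_ege1.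
have WW : W <= W * K ^+ j by rewrite ler_peMr // ltW.
split; [exact: le_trans WW|exact: le_trans WW| |].
  apply: le_trans J1; rewrite [K * _]mulrCA -exprS mulrAC.
  apply: (@le_trans _ _ (W * Z * K ^+ j.+1)).
    by rewrite ler_wpM2r ?(ltW (KJ _)) // ler_wpM2l // ltW.
  by rewrite ler_wpM2l ?ler_weXn2l // ltW.
by rewrite [K * _]mulrCA -exprS; apply: le_trans hj _; rewrite /c; lra.
Qed.

(* The rate [1/20] and the length [80] only have to beat Chebyshev's bound, which
   gives [psi_deficit T >= T / 10 - C]. *)
Lemma chain_steps (g : R -> R) (t0 r : R) : 0 < t0 -> 1 < r ->
  (forall t, t0 <= t < 80 * t0 -> exists2 t', r * t <= t' & g t' - g t <= (t' - t) / 20) ->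
  exists2 T, 80 * t0 <= T & g T - g t0 <= (T - t0) / 20.
Proof.
move=> t00 r1 step.
have [J /andP[_ HJ]] := @geometric_bracket r t0 (80 * t0) r1 t00 ltac:(lra).
have claim i : exists T, [/\ t0 <= T, t0 * r ^+ i <= T \/ 80 * t0 <= T &
    g T - g t0 <= (T - t0) / 20].
  elim: i => [|i [T [h1 h2 h3]]]; first by exists t0; split; [|left|]; rewrite ?expr0; lra.
  have [T40|T40] := leP (80 * t0) T; first by exists T; split => //; right.
  have [|T' h4 h5] := step T; first by lra.
  exists T'; split; [nra|left|lra].
  by rewrite exprSr mulrA; case: h2 => h2; nra.
have [T [h1 h2 h3]] := claim J.+1; exists T => //.
by case: h2; lra.
Qed.

(** Otherwise each summand over [(z, M * z]] is at least [mangoldt n * eta2 * x / (M * z)]. The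
    weights [mangoldt n] add up to more than [d0 * z] there, so the window would contain at least
    [eta2 * d0 * x / M], which is too much. *)
Lemma good_in_window (L M K eta eta2 d0 x w z : R) : 1 < L -> 1 < M -> 0 < eta2 ->
  0 < x -> 0 < w -> w <= z -> M * z <= K * w ->
  2 * (1 + L) * eta * ln K * M < eta2 * d0 ->
  d0 * z < psi (M * z) - psi z ->
  (forall n, w < n%:R <= K * w ->
    0 <= psi_deficit (L * x / n%:R) - psi_deficit (x / n%:R) + eta * L * x / n%:R) ->
  0 <= eta * L * x ->
  isum w (K * w) (fun n => mangoldt n *
      (psi_deficit (L * x / n%:R) - psi_deficit (x / n%:R) + eta * L * x / n%:R))
    <= 2 * (1 + L) * eta * ln K * x ->
  exists2 n, z < n%:R <= M * z &
    psi_deficit (L * x / n%:R) - psi_deficit (x / n%:R) <= eta2 * (x / n%:R).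
Proof.
move=> L1 M1 e20 x0 w0 wz MzK small dense A0 eLx win.
apply: contrapT => no; set A := fun n => _ in win.
have z0 : 0 < z by lra.
have zM : z <= M * z by rewrite ler_peMl; lra.
have h1 : isum z (M * z) A <= isum w (K * w) A.
  rewrite (@isum_cat w z) //; last by lra.
  rewrite (@isum_cat z (M * z) (K * w)) //.
  have : 0 <= isum w z A.
    apply: isum_ge0 => [|n /andP[n1 n2]]; first by lra.
    by rewrite /A mulr_ge0 ?mangoldt_ge0 // A0 //; lra.
  have : 0 <= isum (M * z) (K * w) A.
    apply: isum_ge0 => [|n /andP[n1 n2]]; first by lra.
    by rewrite /A mulr_ge0 ?mangoldt_ge0 // A0 //; lra.
  by lra.
have h2 : eta2 * x / (M * z) * isum z (M * z) mangoldt <= isum z (M * z) A.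
  rewrite -isumZ; apply: ler_isum => [|n /andP[n1 n2]]; first by lra.
  have n0 : 0 < n%:R :> R by lra.
  rewrite /A mulrC ler_wpM2l ?mangoldt_ge0 //.
  have i0 : 0 < n%:R^-1 :> R by rewrite invr_gt0.
  have : ~ (psi_deficit (L * x / n%:R) - psi_deficit (x / n%:R) <= eta2 * (x / n%:R)).
    by move=> h; apply: no; exists n => //; rewrite n1 n2.
  move=> /negP; rewrite -ltNge.
  have : eta2 * x / (M * z) <= eta2 * (x / n%:R).
    rewrite -mulrA ler_wpM2l ?ler_wpM2l ?lef_pV2 ?posrE //; lra.
  have : 0 <= eta * L * x / n%:R by rewrite mulr_ge0 //; lra.
  by lra.
rewrite -psi_isum // in h2; last by lra.
have h3 : eta2 * x / (M * z) * (d0 * z) <= eta2 * x / (M * z) * (psi (M * z) - psi z).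
  by rewrite ler_wpM2l ?divr_ge0 ?mulr_ge0 //; lra.
have E : eta2 * x / (M * z) * (d0 * z) = eta2 * d0 * x / M by field; apply/andP; split; lra.
have : eta2 * d0 * x / M <= 2 * (1 + L) * eta * ln K * x by lra.
rewrite ler_pdivrMr; last by lra.
have : 2 * (1 + L) * eta * ln K * M * x < eta2 * d0 * x by rewrite ltr_pM2r.
by lra.
Qed.

(** If [u <= t], the passages from [t] to [u] and from [u] to [L * u] each cost at most
    [s * t / 40], against [L * u - t >= s * t]. If [u > t], monotonicity of [psi] bounds the first
    cost by [2 * (u - t) <= 6 * s * t], against [L * u - t >= 160 * s * t]. *)
Lemma chain_step (L s eta Z t u : R) : 1 < L -> 0 < s -> 160 * s <= L - 1 -> s <= 1 ->
  eta <= s / 40 ->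
  (forall x y, Z <= x -> x <= y -> psi_deficit x - psi_deficit y <= eta * y) ->
  0 < t -> 0 <= u -> Z <= u -> u < t * (1 + s) ^+ 2 -> (1 + s) * t <= L * u ->
  psi_deficit (L * u) - psi_deficit u <= s / 40 * u ->
  psi_deficit (L * u) - psi_deficit t <= (L * u - t) / 20.
Proof.
move=> L1 s0 sL s1 es HZ t0 u0 Zu u1 u2 hn; set r := 1 + s in u1 u2.
have r2s : r ^+ 2 <= 1 + 3 * s by rewrite /r; nra.
have [ut|ut] := leP u t.
  have := HZ u t Zu ut => h.
  have : s / 40 * u <= s / 40 * t by rewrite ler_wpM2l //; lra.
  have : eta * t <= s / 40 * t by rewrite ler_wpM2r //; lra.
  have : r * t = t + s * t by rewrite /r; ring.
  by lra.
have : psi t <= psi u by apply: psi_mono; lra.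
have : u <= t + 3 * s * t.
  apply: (le_trans (ltW u1)); have : t * r ^+ 2 <= t * (1 + 3 * s) by rewrite ler_wpM2l //; lra.
  by lra.
have : s / 40 * u <= s * u by rewrite ler_wpM2r; lra.
have : s * u <= 4 * (s * t).
  have : s * u <= s * (t * 4) by rewrite ler_wpM2l //; [lra|nra].
  by lra.
have : 160 * (s * t) <= L * t - t.
  have : 160 * s * t <= (L - 1) * t by rewrite ler_wpM2r //; lra.
  by lra.
have : L * t <= L * u by rewrite ler_wpM2l //; lra.
by move: hn; rewrite /psi_deficit; lra.
Qed.

(** As [M = (1 + s) * L] is not bad, each [(z, M * z]] inside a sparse window contains an [n] such
    that the deficit hardly grows from [x / n] to [L * x / n]. Chaining such intervals from [t0]
    past [80 * t0] contradicts Chebyshev's bound. *)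
Lemma no_maximal_bad_ratio (L : R) : 1 < L -> bad_ratio L ->
  ~ (forall M, L < M -> ~ bad_ratio M).
Proof.
move=> L1 bad mx.
have [s [s0 sL s1]] : exists s : R, [/\ 0 < s, 160 * s <= L - 1 & s <= 1].
  exists (Num.min 1 ((L - 1) / 160)).
  have h : Num.min 1 ((L - 1) / 160) <= (L - 1) / 160 by rewrite ge_min lexx orbT.
  by split; [rewrite lt_min; lra|lra|rewrite ge_min lexx].
pose r : R := 1 + s; pose M : R := r * L; pose K : R := 80 * M.
have r1 : 1 < r by rewrite /r; lra.
have LM : L < M by rewrite /M /r; nra.
have [d0 [d00 [X0 dense]]] : exists d0 : R, 0 < d0 /\ exists X0 : R, forall x, X0 <= x ->
    d0 * x < psi (M * x) - psi x.
  apply: contrapT => no; apply: (mx M LM) => d X d_gt0.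
  apply: contrapT => no2; apply: no; exists d; split => //; exists X => x Xx.
  by rewrite ltNge; apply/negP => h; apply: no2; exists x.
pose eta2 := s / 40.
have K1 : 1 < K by rewrite /K; lra.
have lK : 0 < ln K by exact: ln_gt0.
pose c := 4 * (1 + L) * ln K * M.
have c0 : 0 < c by rewrite /c !mulr_gt0 //; lra.
have [eta [e0 es ec]] : exists eta : R, [/\ 0 < eta, eta <= s / 40 &
    2 * (1 + L) * eta * ln K * M < eta2 * d0].
  exists (Num.min (s / 40) (eta2 * d0 / c)).
  have p : 0 < eta2 * d0 / c by rewrite divr_gt0 // mulr_gt0 // /eta2; lra.
  split; [by rewrite lt_min p andbT; lra|by rewrite ge_min lexx|].
  set e := Num.min _ _; have : e <= eta2 * d0 / c by rewrite ge_min lexx orbT.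
  rewrite ler_pdivlMr //; have : 0 < eta2 * d0 by rewrite mulr_gt0 // /eta2; lra.
  by rewrite /c; lra.
have [Z Z1 HZ] := psi_deficit_almost_mono e0.
have [C C0 HC] := chebyshev.
have [x [w [Xw w1 KwZ win]]] := @sparse_window L K eta (2 * (Z + C)) X0 L1 bad K1 e0.
(* As [t] goes from [t0] to [80 * t0], the [z = x / (t * r ^+ 2)] below goes from [80 * w] down to
   [w], so [(z, M * z]] stays in [(w, K * w]] for [K = 80 * M]. *)
pose t0 := x / (80 * r ^+ 2 * w).
have r2 : r <= 2 by rewrite /r; lra.
have rr0 : 0 < r ^+ 2 by rewrite exprn_even_gt0 //= gt_eqF //; lra.
have L0 : 0 < L by lra.
have Kw0 : 0 < K * w by rewrite mulr_gt0; lra.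
have M0 : 0 < M by lra.
have w0 : 0 < w by lra.
have r0 : 0 < r by lra.
have ZC0 : 0 < Z + C by lra.
have x0 : 0 < x by apply: lt_le_trans KwZ; rewrite !mulr_gt0.
have t0x : t0 * (80 * r ^+ 2 * w) = x.
  by rewrite /t0 divfK // gt_eqF // !mulr_gt0.
have t0Z : Z + C <= t0.
  rewrite ler_pdivlMr; last by rewrite !mulr_gt0.
  apply: le_trans KwZ; rewrite /K /M -subr_ge0.
  have -> : 80 * (r * L) * w * (2 * (Z + C)) - (Z + C) * (80 * r ^+ 2 * w) =
     (Z + C) * w * r * 80 * (2 * L - r) by ring.
  by rewrite !mulr_ge0 ?ltW //; lra.
have {}t0x : x = 80 * r ^+ 2 * w * t0 by rewrite mulrC.
have t00 : 0 < t0 by lra.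
have xn n : w < n%:R <= K * w -> Z <= x / n%:R.
  move=> /andP[n1 n2]; rewrite ler_pdivlMr; last by lra.
  apply: le_trans KwZ; apply: (@le_trans _ _ (Z * (K * w))).
    by rewrite ler_wpM2l //; lra.
  by rewrite mulrC ler_wpM2l ?ltW //; lra.
have A0 n : w < n%:R <= K * w ->
    0 <= psi_deficit (L * x / n%:R) - psi_deficit (x / n%:R) + eta * L * x / n%:R.
  move=> wn; have := HZ (x / n%:R) (L * x / n%:R) (xn n wn).
  have n0 : 0 < n%:R^-1 :> R by rewrite invr_gt0 (lt_trans w0) //; case/andP: wn.
  have -> : eta * (L * x / n%:R) = eta * L * x / n%:R by rewrite !mulrA.
  have xL : x / n%:R <= L * x / n%:R by rewrite ler_pM2r // ler_peMl // ltW.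
  by move=> /(_ xL); lra.
have [T T40 HT] : exists2 T, 80 * t0 <= T & psi_deficit T - psi_deficit t0 <= (T - t0) / 20.
  apply: (@chain_steps psi_deficit t0 r) => // t /andP[t0t t40].
  (* For [n] in [(z, M * z]], [u = x / n] satisfies [r * t / L <= u < r ^+ 2 * t]: [L * u] is a
     factor [r] beyond [t], and [u] hardly overshoots [t]. *)
  pose z := x / (t * r ^+ 2).
  have tt0 : 0 < t by exact: lt_le_trans t0t.
  have tr0 : 0 < t * r ^+ 2 by rewrite mulr_gt0.
  have wz : w <= z.
    rewrite ler_pdivlMr // t0x.
    have : w * (t * r ^+ 2) <= w * (80 * t0 * r ^+ 2).
      by rewrite ler_wpM2l ?ler_wpM2r // ltW.
    by lra.
  have MzK : M * z <= K * w.
    have -> : K * w = M * (80 * w) by rewrite /K; ring.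
    rewrite ler_wpM2l //; first by exact: ltW.
    rewrite ler_pdivrMr // t0x.
    have : 80 * w * (r ^+ 2 * t0) <= 80 * w * (r ^+ 2 * t).
      by rewrite ler_wpM2l ?ler_wpM2l // ?mulr_ge0 // ltW.
    by lra.
  have M1 : 1 < M by exact: lt_trans LM.
  have e20 : 0 < eta2 by rewrite divr_gt0.
  have dz : d0 * z < psi (M * z) - psi z by apply: dense; exact: le_trans wz.
  have eLx : 0 <= eta * L * x by rewrite !mulr_ge0 // ltW.
  have [n /andP[n1 n2] hn] := good_in_window L1 M1 e20 x0 w0 wz MzK ec dz A0 eLx win.
  have wnK : w < n%:R <= K * w by rewrite (le_lt_trans wz n1) (le_trans n2 MzK).
  have n0 : 0 < n%:R :> R by case/andP: wnK => + _; exact: lt_trans.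
  have zt : z * (t * r ^+ 2) = x by rewrite divfK // gt_eqF.
  pose u := x / n%:R; have un : u * n%:R = x by rewrite divfK // gt_eqF.
  have Zu : Z <= u by exact: xn.
  have Lu : L * x / n%:R = L * u by rewrite mulrA.
  have u1 : u < t * r ^+ 2.
    rewrite ltr_pdivrMr // mulrC -ltr_pdivrMr //.
  have u2 : r * t <= L * u.
    rewrite -(ler_pM2r n0) -[L * u * _]mulrA un; apply: (@le_trans _ _ (r * t * (M * z))).
      by rewrite ler_wpM2l // mulr_ge0 // ltW.
    by rewrite -zt /M le_eqVlt; apply/orP; left; apply/eqP; ring.
  rewrite Lu -/u in hn; exists (L * u) => //.
  apply: (@chain_step L s eta Z) => //.
  by rewrite divr_ge0 // ltW.
(* The chain gives a deficit of at most [2 * t0 + T / 20 <= 3 * T / 40] at [T], Chebyshev's bound at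
   least [T / 10 - C]; but [T / 40 >= 2 * t0 > C]. *)
have := HC T ltac:(lra); have := psi_ge0 t0.
by move: HT; rewrite /psi_deficit; lra.
Qed.

(** By Mertens's estimate the sum of [mangoldt n / n] over [(x, L * x]] is at least [ln L - 2 * E],
    while it is at most [(psi (L * x) - psi x) / x], hence at most 1 for a suitable [x]. *)
Lemma bad_ratio_bounded : exists B : R, forall L, 1 <= L -> bad_ratio L -> L <= B.
Proof.
have [E E0 HE] := mertens; exists (expR (2 * E + 1)) => L L1 bad.
have [x x1 hx] := bad 1 1 ltr01.
have xL : x <= L * x by rewrite ler_peMl; lra.
have M1 := HE x x1; have M2 := HE (L * x) ltac:(lra).
rewrite (@isum_cat 0 x) in M2; try lra.
have : isum x (L * x) (fun n => mangoldt n / n%:R) <= x^-1 * isum x (L * x) mangoldt.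
  rewrite -isumZ; apply: ler_isum => [|n /andP[n1 n2]]; first by lra.
  by rewrite mulrC ler_wpM2r ?mangoldt_ge0 // lef_pV2 ?posrE; lra.
rewrite -psi_isum; try lra.
have : x^-1 * (psi (L * x) - psi x) <= 1.
  by rewrite mulrC ler_pdivrMr; lra.
move: M1 M2; rewrite lnM ?posrE; try lra.
rewrite !ler_norml => M1 M2 h1 h2.
have : ln L <= 2 * E + 1 by lra.
by rewrite -{1}[2 * E + 1]expRK ler_ln ?posrE ?expR_gt0; lra.
Qed.

(** For [L] in [S] near the supremum [L0], almost monotonicity lets [psi] gain at most
    [2 * (L0 - L) * x + d * x / 4] from [L * x] to [L0 * x]. *)
Lemma bad_ratio_sup (S : set R) : has_sup S -> (forall L, S L -> bad_ratio L) ->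
  1 <= sup S -> bad_ratio (sup S).
Proof.
move=> hs HS s1 d X d0.
pose L0 := sup S.
have L00 : 1 <= L0 by [].
have e0 : 0 < d / (4 * L0) by rewrite divr_gt0 // mulr_gt0 //; lra.
have [Z Z1 HZ] := psi_deficit_almost_mono e0.
(* The margin 1/2 keeps [L > 1/2], so [L * x >= Z] once [x >= 2 * Z]; the margin [d / 8] costs
   [d / 4]. *)
have [L SL hL] := @sup_adherent _ S (Num.min (1/2) (d / 8)) ltac:(by rewrite lt_min; lra) hs.
have [hL1 hL2] : L0 - 1/2 < L /\ L0 - d / 8 < L.
  by move: hL; rewrite /L0; case: (leP (1/2) (d/8)) => *; lra.
have LL0 : L <= L0 by apply: ub_le_sup => //; exact: hs.2.
have [x Xx hx] := HS L SL (d / 4) (Num.max X (2 * Z)) ltac:(lra).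
exists x; first by apply: le_trans Xx; rewrite le_max lexx.
have Zx : 2 * Z <= x by apply: le_trans Xx; rewrite le_max lexx orbT.
have := HZ (L * x) (L0 * x) ltac:(rewrite /L0 in hL1; nra) ltac:(rewrite ler_wpM2r //; lra).
have -> : d / (4 * L0) * (L0 * x) = d / 4 * x by field; rewrite /L0; lra.
have : (L0 - L) * x <= d / 8 * x by rewrite ler_wpM2r //; lra.
have : 0 <= d * x by rewrite mulr_ge0 //; lra.
by rewrite /psi_deficit -/L0; move: (psi _) (psi _) (psi _) hx => *; lra.
Qed.

(** If [L] were bad, the supremum of all bad ratios would be a largest one above 1, against
    [no_maximal_bad_ratio]. *)
Lemma psi_grows (L : R) : 1 < L -> exists d X : R, 0 < d /\
  forall x, X <= x -> d * x < psi (L * x) - psi x.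
Proof.
move=> L1; apply: contrapT => no.
have bad : bad_ratio L.
  move=> d X d0; apply: contrapT => no2; apply: no; exists d, X; split => // x Xx.
  by rewrite ltNge; apply/negP => h; apply: no2; exists x.
have [B HB] := bad_ratio_bounded.
pose S := [set L | 1 <= L /\ bad_ratio L]%classic.
have hs : has_sup S.
  by split; [exists L; split => //; lra|exists B => ? [? ?]; exact: HB].
have sL : L <= sup S by apply: ub_le_sup; [exact: hs.2|split => //; lra].
apply: (@no_maximal_bad_ratio (sup S)); first by lra.
  by apply: bad_ratio_sup => //; [move=> ? []|lra].
move=> M SM bM; have : M <= sup S by apply: ub_le_sup; [exact: hs.2|split => //; lra].
by lra.
Qed.

Lemma prime_power_in_interval (L : R) : 1 < L -> exists X : R, forall x, X <= x ->
  exists p j, [/\ prime p, (0 < j)%N & x < (p ^ j)%:R <= L * x].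
Proof.
move=> L1; have [d [X [d0 H]]] := psi_grows L1.
exists (Num.max X 0) => x; rewrite ge_max => /andP[Xx x0].
have xL : x <= L * x by rewrite ler_peMl; lra.
have := H x Xx; rewrite psi_isum // => h.
have [n nx] : exists2 n, x < n%:R <= L * x & mangoldt n != 0.
  apply: contrapT => no; move: h; rewrite ltNge; apply/negP; rewrite negbK.
  have -> : isum x (L * x) mangoldt = isum x (L * x) (fun n => 0 * mangoldt n).
    apply: eq_isum => // n hn; rewrite mul0r; apply/eqP; apply: contrapT => /negP h.
    by apply: no; exists n.
  by rewrite isumZ mul0r mulr_ge0 // ltW.
by move=> /mangoldt_neq0[p [j [pp j0 En]]]; exists p, j; rewrite -En.
Qed.
End PrimePowerGaps.

(** * Cycles and their labellings *)

Section CycleEmbeddings.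
Variables (T : finType) (E : {set {set T}}).

(** These are the labelled cycles: a starting vertex and a direction are part of the data. *)
Definition cycle_embeddings m : {set {ffun 'I_m -> T}} :=
  [set f : {ffun 'I_m -> T} | injectiveb f
    && [forall i, [set f i; f (ordS i)] \in E]].

Definition cycle_copy m (f : {ffun 'I_m -> T}) : {set T} * {set {set T}} :=
  (f @: [set: 'I_m], [set f @: e | e : {set 'I_m} in cycle_graph m]).

Lemma cycle_embeddingsP m (f : {ffun 'I_m -> T}) :
  reflect (injective f /\ forall i, [set f i; f (ordS i)] \in E)
          (f \in cycle_embeddings m).
Proof.
rewrite inE; apply: (iffP andP) => -[h1 h2]; split.
- exact/injectiveP.
- exact/forallP.
- exact/injectiveP.
- exact/forallP.
Qed.

Lemma cycle_copy_edges m (f : {ffun 'I_m -> T}) :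
  (cycle_copy f).2 = [set [set f i; f (ordS i)] | i : 'I_m].
Proof.
rewrite /cycle_copy /cycle_graph /= -imset_comp.
by apply: eq_imset => i /=; rewrite imsetU1 imset_set1.
Qed.

Lemma copies_cycle m :
  copies (cycle_graph m) E = @cycle_copy m @: cycle_embeddings m.
Proof.
apply/setP => S; rewrite inE; apply/andP/imsetP.
  move=> [SE /existsP[f /andP[fi /eqP ES]]]; exists f => //.
  apply/cycle_embeddingsP; split; first exact/injectiveP.
  move=> i; apply: (fintype.subsetP SE); rewrite ES -[X in _ \in pred_of_set X.2]/(cycle_copy f).
  by rewrite cycle_copy_edges; apply/imsetP; exists i.
move=> [f /cycle_embeddingsP[fi fE] ->]; split.
  rewrite cycle_copy_edges; apply/fintype.subsetP => _ /imsetP[i _ ->]; exact: fE.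
by apply/existsP; exists f; rewrite eqxx andbT; apply/injectiveP.
Qed.

Lemma no_copies_cycle m : copies (cycle_graph m) E = finset.set0 -> cycle_embeddings m = finset.set0.
Proof.
by rewrite copies_cycle => h; apply/eqP; rewrite -(imset_eq0 (@cycle_copy m)) h.
Qed.

Lemma set2_eq (U : finType) (a b c d : U) : [set a; b] = [set c; d] ->
  (a = c /\ b = d) \/ (a = d /\ b = c).
Proof.
move=> h; have ha : a \in [set c; d] by rewrite -h set21.
have hb : b \in [set c; d] by rewrite -h set22.
have hc : c \in [set a; b] by rewrite h set21.
have hd : d \in [set a; b] by rewrite h set22.
move: ha hb hc hd; rewrite !inE.
by do 4![case/orP=> /eqP ?]; subst; auto.
Qed.

(** The symmetries of a cycle of length at least 3, in arithmetic modulo the length. *)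
Definition dihedral n (ab : 'I_n.+3 * bool) (i : 'I_n.+3) : 'I_n.+3 :=
  if ab.2 then ab.1 + i else ab.1 - i.

Lemma ordS_add1 n (i : 'I_n.+3) : ordS i = i + 1.
Proof. by apply: val_inj; rewrite /= modnDmr addn1. Qed.

Lemma dihedral_inj n (ab : 'I_n.+3 * bool) : injective (dihedral ab).
Proof.
case: ab => a [] i j; rewrite /dihedral /=; first exact: addrI.
by move=> /addrI /oppr_inj.
Qed.

Lemma ord_two_neq0 n : (1 + 1 : 'I_n.+3) != 0.
Proof. by []. Qed.

Lemma dihedral_inj2 n : injective (@dihedral n).
Proof.
move=> [a b] [a' b'] h.
have := congr1 (fun f => f 0) h; have := congr1 (fun f => f 1) h.
rewrite /dihedral /= !addr0 !subr0 => h1.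
have -> : (if b then a else a) = a by case: b {h h1}.
have -> : (if b' then a' else a') = a' by case: b' {h h1}.
move=> E'; subst a'; congr (_, _); have n2 := @ord_two_neq0 n.
case: b b' h1 {h} => [] [] //= /addrI h1; case/negP: n2; rewrite addr_eq0;
  by apply/eqP; first [exact: h1|exact: esym h1].
Qed.

Lemma dihedral_cycle_copy n (f : {ffun 'I_n.+3 -> T}) ab :
  f \in cycle_embeddings n.+3 ->
  ([ffun i => f (dihedral ab i)] \in cycle_embeddings n.+3)
  /\ cycle_copy [ffun i => f (dihedral ab i)] = cycle_copy f.
Proof.
move=> /cycle_embeddingsP[fi fE].
have di := @dihedral_inj n ab.
have edge i : exists j, [set f (dihedral ab i); f (dihedral ab (ordS i))]
     = [set f j; f (ordS j)].
  case: ab {di} => a []; rewrite /dihedral /=.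
    by exists (a + i); rewrite !ordS_add1 addrA.
  exists (a - i - 1); rewrite !ordS_add1 opprD addrA subrK.
  by rewrite finset.setUC.
have edge' j : exists i, [set f (dihedral ab i); f (dihedral ab (ordS i))]
     = [set f j; f (ordS j)].
  case: ab {di edge} => a []; rewrite /dihedral /=.
    exists (j - a); rewrite !ordS_add1; congr [set f _; f _]; rewrite addrC ?subrK //.
    by rewrite addrAC subrK.
  exists (a - j - 1); rewrite !ordS_add1 subrK finset.setUC; congr [set f _; f _].
    by rewrite opprB addrC subrK.
  by rewrite !opprD !opprK !addrA subrr add0r.
split.
  apply/cycle_embeddingsP; split; first by move=> i j; rewrite !ffunE => /fi /di.
  by move=> i; rewrite !ffunE; have [j ->] := edge i.
rewrite [LHS]surjective_pairing [RHS]surjective_pairing !cycle_copy_edges.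
congr (_, _); apply/setP => z; apply/imsetP/imsetP.
- by move=> [i _ ->]; exists (dihedral ab i); rewrite ?ffunE ?inE.
- move=> [i _ ->]; have [g _ gK] := injF_bij di.
  by exists (g i); rewrite ?ffunE ?gK ?inE.
- by move=> [i _ ->]; rewrite !ffunE; have [j ->] := edge i; exists j.
- by move=> [j _ ->]; have [i Ei] := edge' j; exists i; rewrite ?ffunE ?Ei.
Qed.

(** [f] is [f0] after an index map [s] that moves by 1 or -1 at each step. Injectivity forbids
    turning back, because 2 is not 0 modulo the length, so [s] keeps its direction. *)
Lemma cycle_copy_dihedral n (f f0 : {ffun 'I_n.+3 -> T}) :
  injective f -> injective f0 -> cycle_copy f = cycle_copy f0 ->
  exists ab, f = [ffun i => f0 (dihedral ab i)].
Proof.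
move=> fi f0i h.
have /(@all_sig _ (fun=> _)) [s Hs] : forall i, {j | f i = f0 j}.
  move=> i; apply: cid.
  have : f i \in (cycle_copy f0).1 by rewrite -h imset_f.
  by move=> /imsetP[j _ ->]; exists j.
have si : injective s by move=> i j sij; apply: fi; rewrite !Hs sij.
have step (i : 'I_n.+3) : s (i + 1) = s i + 1 \/ s (i + 1) = s i - 1.
  have : [set f i; f (ordS i)] \in (cycle_copy f0).2.
    by rewrite -h cycle_copy_edges; apply/imsetP; exists i.
  rewrite cycle_copy_edges => /imsetP[j _]; rewrite !Hs !ordS_add1.
  by case/set2_eq => -[/f0i -> /f0i ->]; [left|right; rewrite addrK].
have ne (i : 'I_n.+3) : i + 1 + 1 != i.
  by rewrite -addrA addrC -subr_eq0 addrK ord_two_neq0.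
have up (i : 'I_n.+3) : s (i + 1) = s i + 1 -> s (i + 1 + 1) = s (i + 1) + 1.
  move=> h1; case: (step (i + 1)) => // h2; case/eqP: (ne i).
  by apply: si; rewrite h2 h1 addrK.
have down (i : 'I_n.+3) : s (i + 1) = s i - 1 -> s (i + 1 + 1) = s (i + 1) - 1.
  move=> h1; case: (step (i + 1)) => // h2; case/eqP: (ne i).
  by apply: si; rewrite h2 h1 subrK.
have natP (P : 'I_n.+3 -> Prop) : (forall j : nat, P j%:R) -> forall i, P i.
  by move=> hP i; rewrite -[i]natr_Zp.
case: (step 0) => h0; rewrite add0r in h0.
  have all1 : forall i, s (i + 1) = s i + 1.
    apply: natP; elim=> [|j IH]; first by rewrite add0r.
    by rewrite -natr1; apply: up.
  exists (s 0, true); apply/ffunP => i; rewrite ffunE Hs; congr (f0 _).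
  rewrite /dihedral /=; move: i; apply: natP; elim=> [|j IH]; first by rewrite addr0.
  by rewrite -natr1 all1 IH addrA.
have all1 : forall i, s (i + 1) = s i - 1.
  apply: natP; elim=> [|j IH]; first by rewrite add0r.
  by rewrite -natr1; apply: down.
exists (s 0, false); apply/ffunP => i; rewrite ffunE Hs; congr (f0 _).
rewrite /dihedral /=; move: i; apply: natP; elim=> [|j IH]; first by rewrite subr0.
by rewrite -natr1 all1 IH opprD addrA.
Qed.

(** The fibres of [cycle_copy] are free orbits of the [2 * m] dihedral maps. *)
Lemma card_cycle_embeddings m : (3 <= m)%N ->
  #|cycle_embeddings m| = (#|copies (cycle_graph m) E| * (2 * m))%N.
Proof.
case: m => [|[|[|n]]] // _; rewrite copies_cycle.
rewrite -sum1_card (partition_big_imset (@cycle_copy n.+3)) /=.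
rewrite -sum_nat_const; apply: eq_bigr => _ /imsetP[f0 f0E ->].
have /cycle_embeddingsP[f0i _] := f0E.
transitivity #|[set [ffun i => f0 (dihedral ab i)] | ab : 'I_n.+3 * bool]|.
  rewrite sum1_card; apply: eq_card => f; rewrite unfold_in /=.
  apply/andP/imsetP.
    move=> [/cycle_embeddingsP[fi _] /eqP h].
    by have [ab ->] := cycle_copy_dihedral fi f0i h; exists ab.
  by move=> [ab _ ->]; have [-> ->] := dihedral_cycle_copy ab f0E.
rewrite card_imset; first by rewrite card_prod card_ord card_bool mulnC.
move=> ab ab' /ffunP h; apply: dihedral_inj2; apply/funext => i.
by have := h i; rewrite !ffunE => /f0i.
Qed.

Lemma alternating_color m (c : T -> bool) (f : {ffun 'I_m.+1 -> T}) :
  (forall x y, [set x; y] \in E -> c x != c y) ->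
  (forall i, [set f i; f (ordS i)] \in E) ->
  forall i, c (f i) = c (f ord0) (+) odd i.
Proof.
move=> hc hE [i im]; elim: i im => [|i IH] im.
  by rewrite addbF; congr (c (f _)); apply: val_inj.
have im' : (i < m.+1)%N by exact: ltnW.
have := hc _ _ (hE (Ordinal im')).
have -> : ordS (Ordinal im') = Ordinal im by apply: val_inj; rewrite /= modn_small.
by rewrite IH /=; case: (c _); case: (c _); case: (odd i).
Qed.

Lemma bipartite_no_odd_cycle m (c : T -> bool) :
  (forall x y, [set x; y] \in E -> c x != c y) -> odd m -> cycle_embeddings m = finset.set0.
Proof.
move=> hc; case: m => // m om; apply/eqP; apply: contraT => /set0Pn[f].
move=> /cycle_embeddingsP[_ fE]; have := hc _ _ (fE ord_max).
have -> : ordS ord_max = ord0 :> 'I_m.+1 by apply: val_inj; rewrite /= modnn.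
have em : odd m = false by apply/negbTE.
by rewrite (alternating_color hc fE ord_max) [odd _]em addbF eqxx.
Qed.

(** Otherwise [x], [y], [x'], [y'] in this order would form a 4-cycle. *)
Lemma common_neighbour_uniq : copies (cycle_graph 4) E = finset.set0 ->
  (forall x, [set x; x] \notin E) ->
  forall x x' y y', x != x' -> [set x; y] \in E -> [set x'; y] \in E ->
  [set x; y'] \in E -> [set x'; y'] \in E -> y = y'.
Proof.
move=> /no_copies_cycle c4 irr x x' y y' xx' e1 e2 e3 e4.
apply/eqP; apply: contraT => yy'.
have ne a b : [set a; b] \in E -> a != b.
  by apply: contraTneq => ->; exact: irr.
pose f : {ffun 'I_4 -> T} := [ffun i => nth x [:: x; y; x'; y'] (i : 'I_4)].
suff : f \in cycle_embeddings 4 by rewrite c4 inE.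
apply/cycle_embeddingsP; split.
  move=> i j; rewrite !ffunE => /eqP; rewrite nth_uniq //= ?ltn_ord //.
    by move=> /eqP; exact: val_inj.
  by rewrite !inE !negb_or xx' yy' (ne _ _ e1) (ne _ _ e3) (eq_sym y) (ne _ _ e2) (ne _ _ e4).
case=> [[|[|[|[|//]]]] ?]; rewrite !ffunE //=; first by rewrite finset.setUC.
by rewrite finset.setUC.
Qed.

(** * Graphs without odd cycles are bipartite *)

Section OddClosedWalks.
Variable e : rel T.

Lemma dup_split (s : seq T) : ~~ uniq s ->
  exists s1 x s2 s3, s = s1 ++ x :: s2 ++ x :: s3.
Proof.
elim: s => // x s IH /=; have [xs _|xs] := boolP (x \in s).
  by case/splitPr: xs => s2 s3; exists [::], x, s2, s3.
by move=> /IH[s1 [y [s2 [s3 ->]]]]; exists (x :: s1), y, s2, s3.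
Qed.

(** At a repeated vertex a closed walk splits into two shorter ones, one of which is odd. *)
Lemma odd_cycle_uniq (c : seq T) : path.cycle e c -> odd (size c) ->
  exists c', [/\ path.cycle e c', uniq c' & odd (size c')].
Proof.
have [n] := ubnP (size c); elim: n c => // n IH c cn cc oc.
have [uc|/dup_split[s1 [x [s2 [s3 Ec]]]]] := boolP (uniq c); first by exists c.
have Er : rot (size s1) c = (x :: s2) ++ x :: (s3 ++ s1).
  by rewrite Ec rot_size_cat /= -catA.
have : path.cycle e (rot (size s1) c) by rewrite rot_cycle.
have sz : size c = (size (x :: s2) + size (x :: (s3 ++ s1)))%N.
  by rewrite -(size_rot (size s1)) Er size_cat.
rewrite Er /= rcons_cat cat_path /= => /and3P[p1 p2 p3].
have c1 : path.cycle e (x :: s2) by rewrite /= rcons_path p1.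
have c2 : path.cycle e (x :: (s3 ++ s1)) by exact: p3.
have [os2|os2] := boolP (odd (size (x :: s2))).
  by apply: (IH (x :: s2)) => //; move: cn; rewrite sz /=; lia.
apply: (IH (x :: (s3 ++ s1))) => //; first by move: cn; rewrite sz /=; lia.
by move: oc; rewrite sz oddD (negPf os2).
Qed.

(** A vertex is coloured by whether an even walk from the root of its component reaches it. An edge
    between two reached vertices closes an odd walk; an edge between two unreached ones would extend
    an odd walk to the first into an even walk to the second. *)
Lemma no_odd_cycle_bipartite : symmetric e ->
  (forall c, path.cycle e c -> uniq c -> ~~ odd (size c)) ->
  exists c : T -> bool, forall x y, e x y -> c x != c y.
Proof.
move=> es noodd.
have cs : connect_sym e by exact: sym_connect_sym.
pose even_walk x := exists p, [/\ path e (fingraph.root e x) p, last (fingraph.root e x) p = x & ~~ odd (size p)].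
exists (fun x => `[< even_walk x >]) => x y exy.
have rxy : fingraph.root e x = fingraph.root e y by apply/(fingraph.rootP cs)/connect1.
apply/eqP => h.
case: (asboolP (even_walk x)) h => [[p [p1 p2 p3]]|nx] /esym.
  move=> /asboolP[q [q1 q2 q3]]; rewrite -rxy in q1 q2.
  set r := fingraph.root e x in p1 p2 q1 q2.
  pose w := p ++ y :: rev (belast r q).
  have w1 : path e r w.
    rewrite cat_path p1 /= p2 exy -{1}q2 rev_path.
    by apply: sub_path q1 => a b; rewrite es.
  have w2 : last r w = r.
    rewrite last_cat /= -q2; case: (q) => // a q' /=.
    by rewrite rev_cons last_rcons.
  have w3 : odd (size w).
    by rewrite size_cat /= size_rev size_belast oddD /= (negPf p3) (negPf q3).
  case/lastP: w w1 w2 w3 => // w z w1; rewrite last_rcons => zr; subst z.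
  rewrite size_rcons => w3.
  have [c' [c1 c2 c3]] := @odd_cycle_uniq (r :: w) w1 w3.
  by move: (noodd c' c1 c2); rewrite c3.
move=> /asboolP; apply.
have /connectP[p p1 p2] : connect e (fingraph.root e x) x.
  by rewrite cs connect_root.
exists (rcons p y); rewrite -rxy rcons_path last_rcons p1 -p2 exy; split => //.
rewrite size_rcons /= negbK; apply: contraPT (nx) => op.
by apply; exists p.
Qed.
End OddClosedWalks.

Lemma odd_cycle_free_bipartite :
  (forall m, (3 <= m)%N -> odd m -> copies (cycle_graph m) E = finset.set0) ->
  (forall x, [set x; x] \notin E) ->
  exists c : T -> bool, forall x y, [set x; y] \in E -> c x != c y.
Proof.
move=> noodd irr; apply: (@no_odd_cycle_bipartite [rel x y | [set x; y] \in E]).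
  by move=> x y /=; rewrite finset.setUC.
move=> [//|x p] cyc up; apply/negP => op.
(* The only odd length below 3 is 1, which would be a loop. *)
have sz : (3 <= (size p).+1)%N.
  case: p op cyc {up} => [|y [|? ?]] //= _; rewrite andbT => h.
  by move: (irr x); rewrite h.
have := no_copies_cycle (noodd _ sz op).
pose f : {ffun 'I_(size p).+1 -> T} := [ffun i => nth x (x :: p) (i : 'I_(size p).+1)].
move=> E0; suff : f \in cycle_embeddings (size p).+1 by rewrite E0 inE.
apply/cycle_embeddingsP; split.
  move=> i j; rewrite !ffunE => /eqP; rewrite nth_uniq //; move/eqP; exact: val_inj.
move=> i; rewrite !ffunE; move: cyc => /= /(pathP x) /(_ i).
rewrite size_rcons ltn_ord => /(_ isT) /=.
have -> : nth x (x :: rcons p x) i = nth x (x :: p) i.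
  by rewrite -rcons_cons nth_rcons /= ltn_ord.
have -> // : nth x (rcons p x) i = nth x (x :: p) (i.+1 %% (size p).+1)%N.
have := ltn_ord i; rewrite ltnS leq_eqVlt => /orP[/eqP Ei|ip].
  by rewrite Ei modnn nth_rcons ltnn eqxx.
by rewrite modn_small ?ltnS // nth_rcons ip.
Qed.

Lemma simple_graph_irrefl : simple_graph E -> forall x, [set x; x] \notin E.
Proof.
move=> /forall_inP h x; apply/negP => /h; rewrite finset.setUid cards1.
by [].
Qed.

(** * The upper bound for bipartite graphs without 4-cycles *)

Section UpperBound.
Variable k : nat.
Hypothesis k_gt1 : (1 < k)%N.

Lemma even_index_proof (j : 'I_k) : (2 * j < 2 * k)%N.
Proof. by rewrite ltn_mul2l ltn_ord. Qed.
Definition even_index j := Ordinal (even_index_proof j).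
Definition odd_index j := ordS (even_index j).

Lemma ordS_odd_index j : ordS (odd_index j) = even_index (ordS j).
Proof.
apply: val_inj; have jk := ltn_ord j; rewrite /= (@modn_small (2 * j).+1); last by lia.
move: jk; rewrite leq_eqVlt => /orP[/eqP jk|jk]; last by rewrite !modn_small; lia.
by rewrite (_ : (2 * j).+2 = 2 * k)%N ?jk ?modnn ?muln0 //; lia.
Qed.

Lemma even_or_odd_index (P : 'I_(2 * k) -> Prop) :
  (forall j, P (even_index j)) -> (forall j, P (odd_index j)) -> forall i, P i.
Proof.
move=> h0 h1 i; have ik : (i./2 < k)%N by have := ltn_ord i; lia.
have [oi|oi] := boolP (odd i).
  suff -> : i = odd_index (Ordinal ik) by [].
  by apply: val_inj => /=; rewrite modn_small; have := ltn_ord i; lia.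
suff -> : i = even_index (Ordinal ik) by [].
by apply: val_inj => /=; lia.
Qed.

Hypothesis c4free : copies (cycle_graph 4) E = finset.set0.
Hypothesis irr : forall x, [set x; x] \notin E.
Variable c : T -> bool.
Hypothesis proper : forall x y, [set x; y] \in E -> c x != c y.

Lemma ordS_neq (j : 'I_k) : ordS j != j.
Proof.
apply/eqP => /(congr1 val) /=; have := ltn_ord j.
rewrite leq_eqVlt => /orP[/eqP jk|jk]; last by rewrite modn_small; lia.
by rewrite jk modnn; lia.
Qed.

(** Each odd-indexed vertex is a common neighbour of two even-indexed ones, distinct since [1 < k],
    and so is determined by them. *)
Lemma even_part_inj : {in cycle_embeddings (2 * k) &,
  injective (fun f : {ffun 'I_(2 * k) -> T} => [ffun j => f (even_index j)])}.
Proof.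
move=> f g /cycle_embeddingsP[fi fE] /cycle_embeddingsP[gi gE] /ffunP h.
have {}h j : f (even_index j) = g (even_index j) by have := h j; rewrite !ffunE.
apply/ffunP; apply: even_or_odd_index => [//|j].
apply: (common_neighbour_uniq c4free irr (x := f (even_index j))
         (x' := f (even_index (ordS j)))).
- apply/negP => /eqP /fi /(congr1 val) /= E'.
  have /eqP : val (ordS j) = val j by rewrite /=; lia.
  by apply/negP; rewrite val_eqE ordS_neq.
- exact: fE.
- by rewrite -ordS_odd_index finset.setUC; exact: fE.
- by rewrite h; exact: gE.
- by rewrite h -ordS_odd_index finset.setUC; exact: gE.
Qed.

Lemma odd_part_inj : {in cycle_embeddings (2 * k) &,
  injective (fun f : {ffun 'I_(2 * k) -> T} => [ffun j => f (odd_index j)])}.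
Proof.
move=> f g /cycle_embeddingsP[fi fE] /cycle_embeddingsP[gi gE] /ffunP h.
have {}h j : f (odd_index j) = g (odd_index j) by have := h j; rewrite !ffunE.
apply/ffunP; apply: even_or_odd_index => [j|//].
rewrite -(ord_predK j) -ordS_odd_index; set i := ord_pred j.
apply: (common_neighbour_uniq c4free irr (x := f (odd_index i))
         (x' := f (odd_index (ordS i)))).
- apply/negP => /eqP /fi /ordS_inj /(congr1 val) /= E'.
  have /eqP : val (ordS i) = val i by rewrite /=; lia.
  by apply/negP; rewrite val_eqE ordS_neq.
- exact: fE.
- by rewrite ordS_odd_index finset.setUC; exact: fE.
- by rewrite h; exact: gE.
- by rewrite h ordS_odd_index finset.setUC; exact: gE.
Qed.

Lemma color_index (f : {ffun 'I_(2 * k) -> T}) j : f \in cycle_embeddings (2 * k) ->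
  let b := c (f (even_index (Ordinal (ltnW k_gt1)))) in
  c (f (even_index j)) = b /\ c (f (odd_index j)) = ~~ b.
Proof.
move=> fE b; have [m Em] : exists m, (2 * k)%N = m.+1 by exists (2 * k).-1; lia.
have P : forall i, c (f i) = b (+) odd i.
  have : val (even_index (Ordinal (ltnW k_gt1))) = 0%N by [].
  rewrite /b; move: (even_index _) => z z0; move: f z z0 fE {b}; rewrite Em => f z z0.
  move=> /cycle_embeddingsP[_ fE] i; rewrite (alternating_color proper fE).
  by congr (c (f _) (+) _); apply: val_inj.
rewrite !P; split; first by rewrite /= mul2n odd_double addbF.
have -> : odd (odd_index j) = true; last by rewrite addbT.
by rewrite /= modn_small; have := ltn_ord j; lia.
Qed.

(** Colours alternate, so the vertices of colour [d] sit at the even indices if [b = d] and at the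
    odd ones otherwise; either half determines the embedding. *)
Lemma card_colored_embeddings (b d : bool) :
  (#|[set f in cycle_embeddings (2 * k)
      | c (f (even_index (Ordinal (ltnW k_gt1)))) == b]|
    <= #|[set x | c x == d]| ^ k)%N.
Proof.
set S := (X in (#|pred_of_set X| <= _)%N).
have W (h : {ffun 'I_(2 * k) -> T} -> {ffun 'I_k -> T}) :
    {in cycle_embeddings (2 * k) &, injective h} ->
    (forall f j, f \in S -> c (h f j) = d) ->
    (#|S| <= #|[set x | c x == d]| ^ k)%N.
  move=> hi hd; rewrite -(card_in_imset (f := h) (D := pred_of_set S)); last first.
    by move=> f g /setIdP[fS _] /setIdP[gS _]; apply: hi.
  rewrite -[X in (_ ^ X)%N](card_ord k) -card_ffun_on; apply: subset_leq_card.
  apply/fintype.subsetP => _ /imsetP[f fS ->]; apply/ffun_onP => j.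
  by rewrite inE hd.
have [bd|bd] := eqVneq b d.
  apply: (W _ even_part_inj) => f j /setIdP[fE /eqP fb]; rewrite ffunE.
  by have /= [-> _] := color_index j fE; rewrite fb.
apply: (W _ odd_part_inj) => f j /setIdP[fE /eqP fb]; rewrite ffunE.
have /= [_ ->] := color_index j fE; rewrite fb.
by move: bd; case: (b); case: (d).
Qed.

(** Take [d] to be the smaller colour class; the 2 on the right counts the colours of the initial
    vertex. *)
Lemma card_cycle_embeddings_le : (2 ^ k * #|cycle_embeddings (2 * k)| <= 2 * #|T| ^ k)%N.
Proof.
have [d hd] : exists d : bool, (2 * #|[set x | c x == d]| <= #|T|)%N.
  have E' : (#|[set x | c x == true]| + #|[set x | c x == false]| = #|T|)%N.
    rewrite -(cardsC [set x | c x == true]); congr (_ + _)%N; apply: eq_card => x.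
    by rewrite !inE; case: (c x).
  have [h|h] := leqP #|[set x | c x == true]| #|[set x | c x == false]|.
    by exists true; lia.
  by exists false; lia.
pose z : 'I_(2 * k) := even_index (Ordinal (ltnW k_gt1)).
have split_card : (#|cycle_embeddings (2 * k)| <=
   #|[set f in cycle_embeddings (2 * k) | c (f z) == true]| +
   #|[set f in cycle_embeddings (2 * k) | c (f z) == false]|)%N.
  apply: leq_trans (leq_card_setU _ _); apply: subset_leq_card.
  apply/fintype.subsetP => f fE; apply/setUP.
  by case cz : (c (f z)); [left|right]; apply/setIdP; rewrite cz.
have h1 := card_colored_embeddings true d; have h2 := card_colored_embeddings false d.
apply: (@leq_trans (2 ^ k * (2 * #|[set x | c x == d]| ^ k))).
  by rewrite leq_mul2l; apply/orP; right; rewrite /z in split_card; lia.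
by rewrite mulnCA leq_mul2l /= -expnMn leq_exp2r //; lia.
Qed.
End UpperBound.

Lemma card_copies_even_cycle_le k : (1 < k)%N -> simple_graph E ->
  family_free odd_cycles_and_C4 E ->
  (#|copies (cycle_graph (2 * k)) E| * (2 ^ k.+1 * k) <= #|T| ^ k)%N.
Proof.
move=> k1 /simple_graph_irrefl irr ff.
have [c proper] := odd_cycle_free_bipartite (fun m m3 om => ff _ _ (Odd_cycle m3 om)) irr.
have := card_cycle_embeddings_le k1 (ff _ _ Four_cycle) irr proper.
rewrite card_cycle_embeddings; last by lia.
rewrite expnS; move: (2 ^ k)%N #|copies _ _| (#|T| ^ k)%N => a b d; nia.
Qed.
End CycleEmbeddings.

(** * The incidence graph of points and non-vertical lines *)

Section AffinePlane.
Variables (F : finFieldType) (T : finType) (iota : (F * F) + (F * F) -> T).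
Hypothesis iota_inj : injective iota.
Implicit Types P Q L : F * F.

(* The line [L] is the non-vertical line [y = L.1 x + L.2]. *)
Definition incident P L := P.2 == L.1 * P.1 + L.2.

(** Vertices outside the image of [iota] stay isolated, so the graph fits on any large enough vertex
    set. *)
Definition plane_graph : {set {set T}} :=
  [set [set iota (inl PL.1); iota (inr PL.2)]
    | PL in [set PL : (F * F) * (F * F) | incident PL.1 PL.2]].

Definition point_side (x : T) := [exists P, x == iota (inl P)].

Lemma point_side_inl P : point_side (iota (inl P)).
Proof. by apply/existsP; exists P. Qed.

Lemma point_side_inr L : point_side (iota (inr L)) = false.
Proof. by apply/existsP => -[P /eqP /iota_inj]. Qed.

Lemma incident_edge P L : incident P L -> [set iota (inl P); iota (inr L)] \in plane_graph.
Proof. by move=> PL; apply/imsetP; exists (P, L); rewrite ?inE. Qed.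

Lemma plane_graphP x y : [set x; y] \in plane_graph -> exists P L, incident P L /\
  ((x = iota (inl P) /\ y = iota (inr L)) \/ (x = iota (inr L) /\ y = iota (inl P))).
Proof.
move=> /imsetP[[P L]]; rewrite inE /= => PL h; exists P, L; split => //.
exact: set2_eq h.
Qed.

Lemma plane_graph_proper x y : [set x; y] \in plane_graph -> point_side x != point_side y.
Proof.
by move=> /plane_graphP[P [L [_ [] []]]] -> ->; rewrite point_side_inl point_side_inr.
Qed.

Lemma plane_graph_simple : simple_graph plane_graph.
Proof.
apply/forall_inP => _ /imsetP[[P L] _ ->] /=.
by rewrite cards2; case: (iota (inl P) =P iota (inr L)) => // h; have := iota_inj h.
Qed.

Lemma incident2_uniq P P' L L' : P != P' -> incident P L -> incident P' L ->
  incident P L' -> incident P' L' -> L = L'.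
Proof.
case: P P' L L' => [x y] [x' y'] [a b] [a' b'] ne.
rewrite /incident /= => /eqP h1 /eqP h2 /eqP h3 /eqP h4.
have : (a - a') * (x - x') = 0.
  have -> : (a - a') * (x - x') = (a * x + b) - (a * x' + b) - (a' * x + b') + (a' * x' + b') by ring.
  by rewrite -h1 -h2 -h3 -h4; ring.
move=> /eqP; rewrite mulf_eq0 !subr_eq0 => /orP[] /eqP E'; subst.
  by move: h3 => /addrI <-.
by rewrite eqxx in ne.
Qed.

(** Read from a point, a 4-cycle is a pair of points on two common lines. One of its first two
    vertices is a point, so it can be read from there. *)
Lemma plane_graph_C4_free : cycle_embeddings plane_graph 4 = finset.set0.
Proof.
apply/eqP; apply: contraT => /set0Pn[f /cycle_embeddingsP[fi fE]].
pose i0 : 'I_4 := ord0; pose i1 := ordS i0; pose i2 := ordS i1; pose i3 := ordS i2.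
have i4 : ordS i3 = i0 by apply: val_inj.
have side x y z : [set x; y] \in plane_graph -> [set y; z] \in plane_graph ->
    forall P, x = iota (inl P) -> exists L Q,
    [/\ incident P L, incident Q L, y = iota (inr L) & z = iota (inl Q)].
  move=> /plane_graphP[P1 [L1 [h1 h]]] /plane_graphP[P2 [L2 [h2 h']]] P xP.
  case: h => -[h3 h4]; last by move: h3; rewrite xP => /iota_inj.
  case: h' => -[h5 h6]; first by move: h5; rewrite h4 => /iota_inj.
  move: h3 h5; rewrite xP h4 => /iota_inj[E1] /iota_inj[E2]; subst.
  by exists L2, P2.
suff K x y z t : x != z -> y != t -> [set x; y] \in plane_graph ->
    [set y; z] \in plane_graph -> [set z; t] \in plane_graph ->
    [set t; x] \in plane_graph -> ~ point_side x.
  have ps : point_side (f i0) || point_side (f i1).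
    by have := plane_graph_proper (fE i0); case: (point_side (f i0)) => //=; case: (point_side _).
  have e0 := fE i0; have e1 := fE i1; have e2 := fE i2; have e3 := fE i3.
  rewrite i4 in e3.
  suff : False by []; case/orP: ps.
    by apply: (K _ (f i1) (f i2) (f i3)) => //; apply/eqP => /fi.
  by apply: (K _ (f i2) (f i3) (f i0)) => //; apply/eqP => /fi.
move=> xz yt e1 e2 e3 e4 /existsP[P /eqP xP].
have [L [Q [h1 h2 h3 h4]]] := side _ _ _ e1 e2 _ xP.
have [L' [Q' [h5 h6 h7 h8]]] := side _ _ _ e3 e4 _ h4.
case/eqP: yt; rewrite h3 h7; congr (iota (inr _)).
move: h8; rewrite xP => /iota_inj[E']; subst Q'.
apply: (@incident2_uniq P Q) => //; apply: contraNneq xz => PQ.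
by rewrite xP h4 PQ.
Qed.

Lemma plane_graph_free : family_free odd_cycles_and_C4 plane_graph.
Proof.
have noc n : cycle_embeddings plane_graph n = finset.set0 ->
    copies (cycle_graph n) plane_graph = finset.set0.
  by move=> h; rewrite copies_cycle h imset0.
move=> m H [n n3 on|]; apply: noc; last exact: plane_graph_C4_free.
exact: bipartite_no_odd_cycle plane_graph_proper on.
Qed.

(** For equal abscissas the division by 0 yields slope 0: [P] always lies on the line, [Q] need
    not. *)
Definition line_through P Q : F * F :=
  let a := (Q.2 - P.2) / (Q.1 - P.1) in (a, P.2 - a * P.1).

Lemma line_throughl P Q : incident P (line_through P Q).
Proof. by rewrite /incident /= subrKC. Qed.

Lemma line_throughr P Q : P.1 != Q.1 -> incident Q (line_through P Q).
Proof.
move=> ne; rewrite /incident /=; apply/eqP; set a := _ / _.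
have -> : a * Q.1 + (P.2 - a * P.1) = a * (Q.1 - P.1) + P.2 by ring.
by rewrite divfK ?subrK // subr_eq0 eq_sym.
Qed.

(** * Tuples of points in general position and the cycles they span *)

Section GeneralPosition.
Variable k : nat.
Hypothesis k_gt2 : (2 < k)%N.

Definition general_position : {set {ffun 'I_k -> F * F}} :=
  [set p : {ffun 'I_k -> F * F} |
    [forall i : 'I_k, forall j : 'I_k, (i != j) ==> ((p i).1 != (p j).1)] &&
    [forall i : 'I_k, forall j : 'I_k, forall l : 'I_k, (l != i) && (l != j) && (i != j) ==>
       ~~ incident (p l) (line_through (p i) (p j))]].

Lemma half_index_proof (i : 'I_(2 * k)) : (i./2 < k)%N.
Proof. by have := ltn_ord i; lia. Qed.
Definition half_index i := Ordinal (half_index_proof i).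

Lemma half_even_index j : half_index (@even_index k j) = j.
Proof. by apply: val_inj => /=; rewrite mul2n doubleK. Qed.

Lemma half_odd_index j : half_index (@odd_index k j) = j.
Proof.
apply: val_inj => /=; have := ltn_ord j => jk.
by rewrite modn_small; lia.
Qed.

Lemma odd_odd_index j : odd (@odd_index k j).
Proof. by rewrite /=; have := ltn_ord j => jk; rewrite modn_small; lia. Qed.

Definition plane_cycle (p : {ffun 'I_k -> F * F}) : {ffun 'I_(2 * k) -> T} :=
  [ffun i : 'I_(2 * k) => let j := half_index i in
    iota (if odd i then inr (line_through (p j) (p (ordS j))) else inl (p j))].

Lemma plane_cycle_even p j : plane_cycle p (even_index j) = iota (inl (p j)).
Proof. by rewrite ffunE /= mul2n odd_double half_even_index. Qed.

Lemma plane_cycle_odd p j :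
  plane_cycle p (odd_index j) = iota (inr (line_through (p j) (p (ordS j)))).
Proof. by rewrite ffunE odd_odd_index half_odd_index. Qed.

Lemma plane_cycle_embedding p : p \in general_position ->
  plane_cycle p \in cycle_embeddings plane_graph (2 * k).
Proof.
have k1 : (1 < k)%N by exact: ltnW.
rewrite inE => /andP[/forallP h1 /forallP h2].
have {}h1 i j : i != j -> (p i).1 != (p j).1.
  by move: (h1 i) => /forallP /(_ j) /implyP.
have {}h2 i j l : l != i -> l != j -> i != j -> ~~ incident (p l) (line_through (p i) (p j)).
  move=> a b c; move: (h2 i) => /forallP /(_ j) /forallP /(_ l) /implyP.
  by apply; rewrite a b c.
have on_next j : incident (p (ordS j)) (line_through (p j) (p (ordS j))).
  by apply/line_throughr/h1; rewrite eq_sym ordS_neq.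
have pinj i j : p i = p j -> i = j.
  by move=> pij; apply/eqP; apply: contraT => /h1; rewrite pij eqxx.
(* If two such lines coincide, a third point lies on the line at [i]: [p j], or, when [j] is the
   successor of [i], the point after it, which is not [p i] because [2 < k]. *)
have linj i j : line_through (p i) (p (ordS i)) = line_through (p j) (p (ordS j)) -> i = j.
  move=> E'; apply/eqP; apply: contraT => ij.
  have [jS|jS] := eqVneq j (ordS i); last first.
    have := h2 i (ordS i) j; rewrite eq_sym ij jS eq_sym ordS_neq // => /(_ isT isT isT).
    by rewrite E' line_throughl.
  have := h2 i (ordS i) (ordS j); rewrite -jS ordS_neq // ij.
  have -> : ordS j != i.
    rewrite jS; apply/eqP => /(congr1 val) /=; have := ltn_ord i.
    rewrite leq_eqVlt => /orP[/eqP ik|ik].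
      by rewrite ik modnn modn_small; lia.
    rewrite (@modn_small i.+1) //; move: ik; rewrite leq_eqVlt => /orP[/eqP ik|ik].
      by rewrite ik modnn; lia.
    by rewrite modn_small; lia.
  by move=> /(_ isT isT isT); rewrite [X in line_through _ (p X)]jS E' on_next.
apply/cycle_embeddingsP; split.
  apply: even_or_odd_index => // i; apply: even_or_odd_index => // j.
  - by rewrite !plane_cycle_even => /iota_inj[/pinj ->].
  - by rewrite plane_cycle_even plane_cycle_odd => /iota_inj.
  - by rewrite plane_cycle_even plane_cycle_odd => /iota_inj.
  - rewrite !plane_cycle_odd => /iota_inj.
    by move=> /(congr1 (fun z => if z is inr L then L else p i)) /linj ->.
apply: even_or_odd_index => // j.
  rewrite -[ordS _]/(odd_index j) plane_cycle_even plane_cycle_odd.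
  exact/incident_edge/line_throughl.
rewrite ordS_odd_index // plane_cycle_even plane_cycle_odd finset.setUC.
exact/incident_edge/on_next.
Qed.

(** Shifting the labels by one gives a disjoint family of embeddings that start at a line. This
    factor 2 is needed against the [4 * k] labellings of each copy. *)
Lemma card_embeddings_plane :
  (2 * #|general_position| <= #|cycle_embeddings plane_graph (2 * k)|)%N.
Proof.
have k1 : (1 < k)%N by exact: ltnW.
have pci : injective plane_cycle.
  move=> p q /ffunP h; apply/ffunP => j; have := h (even_index j).
  by rewrite !plane_cycle_even => /iota_inj[].
pose shift (f : {ffun 'I_(2 * k) -> T}) := [ffun i => f (ordS i)].
have shi : injective shift.
  move=> f g /ffunP h; apply/ffunP => j; have := h (ord_pred j).
  by rewrite !ffunE ord_predK.
pose A := plane_cycle @: general_position.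
have cA : #|A| = #|general_position| by rewrite card_imset.
have cB : #|shift @: A| = #|general_position| by rewrite card_imset.
have z : 'I_k by exists 0%N; lia.
have dis : [disjoint A & shift @: A].
  rewrite -setI_eq0; apply/eqP/setP => f; rewrite inE [RHS]inE; apply/andP => -[].
  move=> /imsetP[p _ ->] /imsetP[_ /imsetP[q _ ->]] /ffunP /(_ (even_index z)).
  rewrite [RHS]ffunE -[ordS _]/(odd_index z) plane_cycle_even plane_cycle_odd.
  by move=> /iota_inj.
rewrite mul2n -addnn -{1}cA -cB -cardsUI (disjoint_setI0 dis) cards0 addn0.
apply: subset_leq_card; apply/fintype.subsetP => f /setUP[] /imsetP[g].
  by move=> gp ->; exact: plane_cycle_embedding.
move=> /imsetP[p gp ->] ->; have /cycle_embeddingsP[pi pE] := plane_cycle_embedding gp.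
have sE i : shift (plane_cycle p) i = plane_cycle p (ordS i) by rewrite [LHS]ffunE.
apply/cycle_embeddingsP; split; first by move=> i j; rewrite !sE => /pi /ordS_inj.
by move=> i; rewrite !sE; exact: pE.
Qed.

Definition set_coord (p : {ffun 'I_k -> F * F}) l P : {ffun 'I_k -> F * F} :=
  [ffun i => if i == l then P else p i].

(** Overwriting the abscissa of [p j] by a free scalar is injective on these tuples, since the lost
    value can be read off [p i]. *)
Lemma card_same_abscissa i j : i != j ->
  (#|[set p : {ffun 'I_k -> F * F} | (p i).1 == (p j).1]| * #|F| <= (#|F| ^ 2) ^ k)%N.
Proof.
move=> ij; set B := (X in (#|pred_of_set X| * _ <= _)%N).
have -> : ((#|F| ^ 2) ^ k = #|{: {ffun 'I_k -> F * F}}|)%N.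
  by rewrite card_ffun card_prod card_ord.
rewrite -[#|F|]cardsT -cardsX.
pose h (pt : {ffun 'I_k -> F * F} * F) := set_coord pt.1 j (pt.2, (pt.1 j).2).
apply: (@leq_card_in _ _ h) => -[p t] [q u]; rewrite !finset.in_setX !inE !andbT /=.
move=> /eqP hp /eqP hq /ffunP E'.
have := E' j; rewrite !ffunE eqxx => -[tu y2].
have Ei l : l != j -> p l = q l by move=> lj; have := E' l; rewrite !ffunE (negPf lj).
congr (_, _) => //; apply/ffunP => l; have [->|/Ei//] := eqVneq l j.
rewrite [LHS]surjective_pairing [RHS]surjective_pairing; congr (_, _) => //.
by rewrite -hp -hq Ei.
Qed.

(** Here the ordinate of [p l] is overwritten; its abscissa and the line recover it. *)
Lemma card_collinear i j l : l != i -> l != j ->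
  (#|[set p : {ffun 'I_k -> F * F} | incident (p l) (line_through (p i) (p j))]| * #|F|
    <= (#|F| ^ 2) ^ k)%N.
Proof.
move=> li lj; set B := (X in (#|pred_of_set X| * _ <= _)%N).
have -> : ((#|F| ^ 2) ^ k = #|{: {ffun 'I_k -> F * F}}|)%N.
  by rewrite card_ffun card_prod card_ord.
rewrite -[#|F|]cardsT -cardsX.
pose h (pt : {ffun 'I_k -> F * F} * F) := set_coord pt.1 l ((pt.1 l).1, pt.2).
apply: (@leq_card_in _ _ h) => -[p t] [q u]; rewrite !finset.in_setX !inE !andbT /=.
move=> /eqP hp /eqP hq /ffunP E'.
have := E' l; rewrite !ffunE eqxx => -[x2 tu].
have Ei n : n != l -> p n = q n by move=> nl; have := E' n; rewrite !ffunE (negPf nl).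
congr (_, _) => //; apply/ffunP => n; have [->|/Ei//] := eqVneq n l.
rewrite [LHS]surjective_pairing [RHS]surjective_pairing; congr (_, _) => //.
by rewrite hp hq x2 (Ei i) 1?eq_sym // (Ei j) 1?eq_sym.
Qed.

(** Union bound over [k ^ 2] pairs and [k ^ 3] triples of indices, each excluding at most a
    proportion [1 / #|F|] of all tuples. *)
Lemma card_general_position :
  (#|F| * (#|F| ^ 2) ^ k <=
   #|general_position| * #|F| + (k ^ 2 + k ^ 3) * (#|F| ^ 2) ^ k)%N.
Proof.
pose B2 (ij : 'I_k * 'I_k) := if ij.1 != ij.2 then
  [set p : {ffun 'I_k -> F * F} | (p ij.1).1 == (p ij.2).1] else finset.set0.
pose B3 (t : 'I_k * 'I_k * 'I_k) := if (t.2 != t.1.1) && (t.2 != t.1.2) then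
  [set p : {ffun 'I_k -> F * F} | incident (p t.2) (line_through (p t.1.1) (p t.1.2))]
  else finset.set0.
have union_card (I : finType) (B : I -> {set {ffun 'I_k -> F * F}}) :
    (forall t, #|B t| * #|F| <= (#|F| ^ 2) ^ k)%N ->
    (#|\bigcup_t B t| * #|F| <= #|I| * (#|F| ^ 2) ^ k)%N.
  move=> hB; apply: (@leq_trans ((\sum_t #|B t|) * #|F|)).
    rewrite leq_mul2r; apply/orP; right.
    elim/big_rec2: _ => [|t n A _ IH]; first by rewrite cards0.
    by apply: leq_trans (leq_card_setU _ _) _; rewrite leq_add2l.
  by rewrite big_distrl /= -sum_nat_const; apply: leq_sum => t _.
have h2 : (#|\bigcup_t B2 t| * #|F| <= k ^ 2 * (#|F| ^ 2) ^ k)%N.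
  rewrite -[in (k ^ 2)%N](card_ord k) -mulnn -card_prod; apply: union_card => -[i j].
  rewrite /B2 /=; case: ifP => [ij|_]; last by rewrite cards0.
  exact: card_same_abscissa.
have h3 : (#|\bigcup_t B3 t| * #|F| <= k ^ 3 * (#|F| ^ 2) ^ k)%N.
  rewrite (_ : (k ^ 3)%N = #|{: 'I_k * 'I_k * 'I_k}|); last first.
    by rewrite !card_prod card_ord !expnS expn0 muln1 mulnA.
  apply: union_card => -[[i j] l]; rewrite /B3 /=.
  case: ifP => [/andP[li lj]|_]; last by rewrite cards0.
  exact: card_collinear.
have cover : [set: {ffun 'I_k -> F * F}] \subset
    general_position :|: (\bigcup_t B2 t :|: \bigcup_t B3 t).
  apply/fintype.subsetP => p _; rewrite inE; have [//|] := boolP (p \in general_position).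
  rewrite inE negb_and !negb_forall => /orP[/existsP[i]|/existsP[i]].
    rewrite negb_forall => /existsP[j]; rewrite negb_imply negbK => /andP[ij ei].
    apply/setUP; left; apply/bigcupP; exists (i, j) => //.
    by rewrite /B2 /= ij inE.
  rewrite negb_forall => /existsP[j]; rewrite negb_forall => /existsP[l].
  rewrite negb_imply negbK => /andP[/andP[/andP[li lj] ij] inc].
  apply/setUP; right; apply/bigcupP; exists (i, j, l) => //.
  by rewrite /B3 /= li lj inE.
have := subset_leq_card cover; rewrite cardsT card_ffun card_prod card_ord -mulnn => h1.
have h4 := leq_card_setU general_position (\bigcup_t B2 t :|: \bigcup_t B3 t).
have h5 := leq_card_setU (\bigcup_t B2 t) (\bigcup_t B3 t).
have {h4 h5}h6 := leq_trans h1 (leq_trans h4 (leq_add (leqnn _) h5)).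
rewrite -mulnn in h2 h3 *.
have : (#|F| * (#|F| * #|F|) ^ k <=
    #|F| * (#|general_position| + (#|\bigcup_t B2 t| + #|\bigcup_t B3 t|)))%N.
  by rewrite leq_mul2l h6 orbT.
by move: h2 h3; move: ((#|F| * #|F|) ^ k)%N (k ^ 2)%N (k ^ 3)%N => a b c; lia.
Qed.
End GeneralPosition.
End AffinePlane.

Lemma ex_turan_ge (F : finFieldType) (k v : nat) : (2 < k)%N ->
  (2 * #|F| ^ 2 <= v)%N ->
  (#|F| * (#|F| ^ 2) ^ k <=
   2 * k * ex_turan v (cycle_graph (2 * k)) odd_cycles_and_C4 * #|F|
   + (k ^ 2 + k ^ 3) * (#|F| ^ 2) ^ k)%N.
Proof.
move=> k2 qv.
have cV : (#|{: (F * F) + (F * F)}| <= v)%N by rewrite card_sum card_prod mulnn addnn -mul2n.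
pose iota (x : (F * F) + (F * F)) : 'I_v := widen_ord cV (enum_rank x).
have iota_inj : injective iota.
  by move=> x y /(congr1 val) /= /val_inj /enum_rank_inj.
apply: leq_trans (card_general_position F k2) _; rewrite leq_add2r leq_mul2r.
apply/orP; right; have := card_embeddings_plane iota_inj k2.
rewrite card_cycle_embeddings; last by lia.
have : (#|copies (cycle_graph (2 * k)) (plane_graph iota)| <=
   ex_turan v (cycle_graph (2 * k)) odd_cycles_and_C4)%N.
  apply: (@bigop.leq_bigmax_cond _ _ (fun E => #|copies (cycle_graph (2 * k)) E|)).
  rewrite plane_graph_simple //; apply/asboolP; exact: plane_graph_free.
by move: #|copies _ _| (ex_turan _ _ _) #|general_position _ _| => a b c; nia.
Qed.

Lemma ex_turan_le (k v : nat) : (1 < k)%N ->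
  (ex_turan v (cycle_graph (2 * k)) odd_cycles_and_C4 * (2 ^ k.+1 * k) <= v ^ k)%N.
Proof.
move=> k1; rewrite -leq_divRL; last by rewrite muln_gt0 expn_gt0; lia.
apply/bigmax_leqP => E /andP[sE /asboolP fE]; rewrite leq_divRL; last first.
  by rewrite muln_gt0 expn_gt0; lia.
by rewrite -[X in (_ <= X ^ _)%N](card_ord v); apply: card_copies_even_cycle_le.
Qed.

(** * The asymptotic formula *)

Import numFieldNormedType.Exports.
Local Open Scope classical_set_scope.
Local Open Scope ring_scope.

Lemma bernoulli_sub (R : realType) (a : R) (n : nat) : 0 <= a <= 1 ->
  1 - n%:R * a <= (1 - a) ^+ n.
Proof.
move=> /andP[a0 a1]; elim: n => [|n IH]; first by rewrite mul0r subr0 expr0.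
rewrite exprS -natr1; apply: le_trans (_ : (1 - a) * (1 - n%:R * a) <= _).
  have : 0 <= n%:R * (a * a) :> R by rewrite !mulr_ge0.
  by lra.
by rewrite ler_wpM2l //; lra.
Qed.

Lemma ex_turan_asymp (R : realType) (k : nat) (d : R) : (2 < k)%N -> 0 < d < 1 ->
  exists N : nat, forall v, (N <= v)%N ->
  (2 ^+ k.+1 * k%:R)^-1 * (1 - d) * v%:R ^+ k
    <= (ex_turan v (cycle_graph (2 * k)) odd_cycles_and_C4)%:R :> R.
Proof.
move=> k2 /andP[d0 d1].
have k0 : 0 < k%:R :> R by rewrite ltr0n; lia.
(* A prime power [q] with [(1 - a) * s < q <= s], [s = sqrt (v / 2)], loses a factor of at least
   [(1 - a) ^+ (2 * k) >= 1 - d / 2], by Bernoulli's inequality. *)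
pose a : R := d / (4 * k%:R).
have a0 : 0 < a by rewrite divr_gt0 // mulr_gt0.
have ka : 4 * k%:R * a = d by rewrite mulrC divfK // gt_eqF // mulr_gt0.
have k1 : 1 <= k%:R :> R by rewrite ler1n; lia.
have a1 : a < 1 by nra.
pose L : R := (1 - a)^-1.
have L0 : 0 < L by rewrite invr_gt0; lra.
have La : (1 - a) * L = 1 by rewrite divff //; lra.
have L1 : 1 < L by rewrite invf_gt1; lra.
have [X HX] := prime_power_in_interval L1.
pose c : R := k%:R ^+ 2 + k%:R ^+ 3.
have c0 : 0 <= c by rewrite addr_ge0 ?exprn_ge0 //; lra.
(* Beyond [X] prime powers are available; beyond [2 * c / d] the tuples not in general position cost
   a second factor of at least [1 - d / 2]. *)
pose B : R := Num.max X (2 * c / d).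
pose W : R := 2 * (L * B) ^+ 2.
exists (Num.bound W) => v Nv.
have vW : W <= v%:R.
  apply: ltW; apply: (@lt_le_trans _ _ (Num.bound W)%:R); last by rewrite ler_nat.
  by apply: archi_boundP; rewrite /W mulr_ge0 // exprn_even_ge0.
pose s : R := Num.sqrt (v%:R / 2).
have s0 : 0 <= s by exact: sqrtr_ge0.
have s2 : s ^+ 2 = v%:R / 2 by rewrite sqr_sqrtr // divr_ge0.
have Bs : B <= (1 - a) * s.
  have LBs : L * B <= s.
    have [LB|LB] := leP (L * B) 0; first by lra.
    by rewrite -(@ler_pXn2r _ 2) ?nnegrE // ?s2; [rewrite ler_pdivlMr //; rewrite /W in vW; lra|lra].
  have : (1 - a) * (L * B) <= (1 - a) * s by rewrite ler_wpM2l //; lra.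
  by rewrite mulrA La mul1r.
have Xs : X <= (1 - a) * s by apply: le_trans Bs; rewrite le_max lexx.
have cs : 2 * c / d <= (1 - a) * s by apply: le_trans Bs; rewrite le_max lexx orbT.
have [p [j [pp j0 /andP[q1 q2]]]] := HX _ Xs.
have {q2}q2 : (p ^ j)%:R <= s by apply: le_trans q2 _; rewrite mulrA [L * _]mulrC La mul1r.
have [F _ cF] := PrimePowerField pp j0.
rewrite -cF in q1 q2.
have qv : (2 * #|F| ^ 2 <= v)%N.
  rewrite -(ler_nat R) natrM natrX.
  have : #|F|%:R ^+ 2 <= s ^+ 2 :> R by rewrite ler_pXn2r ?nnegrE.
  by rewrite s2; lra.
have := ex_turan_ge k2 qv; set e := ex_turan _ _ _.
rewrite -(ler_nat R) natrD !natrM natrD !natrX.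
set q : R := #|F|%:R in q1 q2 *; rewrite -/c => H.
have q0 : 0 < q by apply: le_lt_trans q1; rewrite mulr_ge0 //; lra.
have cq : c <= q * (d / 2).
  have : 2 * c / d <= q by lra.
  by rewrite ler_pdivrMr //; lra.
set Q := (q ^+ 2) ^+ k in H *.
have Q0 : 0 <= Q by rewrite exprn_ge0 // exprn_ge0 // ltW.
have H1 : Q * (1 - d / 2) <= 2 * k%:R * e%:R.
  rewrite -(ler_pM2r q0); have : c * Q <= q * (d / 2) * Q by rewrite ler_wpM2r.
  by lra.
have H2 : (v%:R / 2) ^+ k * (1 - d / 2) <= Q.
  have b := @bernoulli_sub R a (2 * k) ltac:(lra).
  have b' : 1 - d / 2 <= (1 - a) ^+ (2 * k).
    by apply: le_trans b; rewrite natrM; lra.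
  apply: (@le_trans _ _ ((v%:R / 2) ^+ k * (1 - a) ^+ (2 * k))).
    by rewrite ler_wpM2l // exprn_ge0 // divr_ge0.
  have p0 : 0 <= s * (1 - a) by rewrite mulr_ge0 //; lra.
  rewrite (exprM _ 2 k) -s2 -!exprMn /Q -!exprM; apply: lerXn2r; rewrite ?nnegrE //; lra.
have H3 : (v%:R / 2) ^+ k * (1 - d) <= 2 * k%:R * e%:R.
  apply: le_trans H1; apply: (@le_trans _ _ ((v%:R / 2) ^+ k * (1 - d / 2) * (1 - d / 2))).
    rewrite -mulrA ler_wpM2l ?exprn_ge0 ?divr_ge0 //.
    have : 0 <= (d / 2) ^+ 2 by exact: sqr_ge0.
    by lra.
  by rewrite ler_wpM2r //; lra.
have p2 : 0 < 2 ^+ k :> R by rewrite exprn_gt0.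
move: H3; rewrite expr_div_n => H3.
have -> : (2 ^+ k.+1 * k%:R)^-1 * (1 - d) * v%:R ^+ k =
   (2 * k%:R)^-1 * (v%:R ^+ k / 2 ^+ k * (1 - d)) :> R.
  by rewrite exprS; field; rewrite !gt_eqF.
by rewrite ler_pdivrMl ?mulr_gt0.
Qed.

Theorem theorem2 (R : realType) (k : nat) (hk : (4 <= k)%N) :
  exists eps : nat -> R,
    (eps v @[v --> \oo] --> (0 : R)) /\
    forall v : nat,
      (ex_turan v (cycle_graph (2 * k)) odd_cycles_and_C4)%:R
      = ((2 ^+ k.+1 * k%:R)^-1 - eps v) * v%:R ^+ k.
Proof.
have k0 : 0 < k%:R :> R by rewrite ltr0n; lia.
pose A : R := (2 ^+ k.+1 * k%:R)^-1.
have A0 : 0 < A by rewrite invr_gt0 mulr_gt0 // exprn_gt0.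
have A1 : A <= 1.
  rewrite invf_le1 ?mulr_gt0 ?exprn_gt0 // -natrX -natrM ler1n muln_gt0 expn_gt0 /=.
  by lia.
pose ex v : R := (ex_turan v (cycle_graph (2 * k)) odd_cycles_and_C4)%:R.
have exle v : ex v <= A * v%:R ^+ k.
  have := @ex_turan_le k v ltac:(lia).
  rewrite -(ler_nat R) !natrM !natrX -/(ex v) => h.
  by rewrite mulrC ler_pdivlMr // mulr_gt0 // exprn_gt0.
exists (fun v => A - ex v / v%:R ^+ k); split; last first.
  (* At [v = 0] one cannot cancel [v ^+ k], but both sides vanish, the left one by the upper
     bound. *)
  move=> v; rewrite -/(ex v) opprB addrC subrK; case: v => [|v].
    rewrite expr0n /= (_ : (k == 0%N) = false); last by lia.
    rewrite mulr0; apply/eqP; rewrite eq_le ler0n andbT.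
    by have := exle 0%N; rewrite expr0n /= (_ : (k == 0%N) = false) ?mulr0 //; lia.
  by rewrite divfK // expf_neq0 // pnatr_eq0.
apply/cvgrPdist_le => e e0.
(* The 1/2 keeps [d] below 1, and [A <= 1] gives [A * d <= e]. *)
pose d := Num.min (1 / 2) e.
have d01 : 0 < d < 1 by rewrite /d lt_min gt_min e0; lra.
have [N HN] := @ex_turan_asymp R k d ltac:(lia) d01.
exists N.+1 => // v /= Nv.
have v0 : 0 < v%:R ^+ k :> R by rewrite exprn_gt0 // ltr0n; lia.
rewrite sub0r normrN ger0_norm; last first.
  by rewrite subr_ge0 ler_pdivrMr.
have := HN v ltac:(lia); rewrite -/(ex v) -/A => h.
have : A * (1 - d) <= ex v / v%:R ^+ k by rewrite ler_pdivlMr.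
have : A * d <= 1 * d by rewrite ler_wpM2r //; lra.
have : d <= e by rewrite ge_min lexx orbT.
by lra.
Qed.
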